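(* Let $V=(J,(V_j)_{j\in J},d,H)$ be a hypergraph system and let $(\nu_e)_{e\in H}$ be a pseudorandom system of measures on $V$. Let $e\in H$ and let $f_e:V_e\to[0,\infty)$ satisfy $0\le f_e(x_e)\le\nu_e(x_e)$ for all $x_e\in V_e$. Let $0<\varepsilon<1$ be sufficiently small, and assume $N$ is sufficiently large depending on $\varepsilon$. Then there exist a $\sigma$-algebra $\mathcal{B}_e$ on $V_e$ and a set $\Omega_e\in\mathcal{B}_e$ such that $$\mathbb{E}\big(1_{\Omega_e}(x_e)\nu_e(x_e)\mid x_e\in V_e\big)=o_{N\to\infty;\varepsilon}(1),$$ $$\mathbb{E}(\nu_e\mid\mathcal{B}_e)(x_e)=1+o_{N\to\infty;\varepsilon}(1)\quad\text{for all }x_e\in V_e\setminus\Omega_e,$$ and $$\big\|(1-1_{\Omega_e})\big(f_e-\mathbb{E}(f_e\mid\mathcal{B}_e)\big)\big\|_{\Box^e}\le\varepsilon^{1/2^{|J|}}.$$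
   Context: A hypergraph system is a quadruple $V=(J,(V_j)_{j\in J},d,H)$ where $J$ is a finite set, each $V_j$ is a finite nonempty set, $d\ge1$ is an integer and $H\subseteq\binom{J}{d}:=\{e\subseteq J:|e|=d\}$; for $e\subseteq J$ put $V_e:=\prod_{j\in e}V_j$. For a $\sigma$-algebra $\mathcal{B}$ on the finite set $V_e$ and $f:V_e\to\mathbb{R}$, $\mathbb{E}(f\mid\mathcal{B})(x)$ is the average of $f$ (uniform measure) over the atom of $\mathcal{B}$ containing $x$. For a finite nonempty set $Z$ and $f:Z\to\mathbb{R}$, $\mathbb{E}(f(x)\mid x\in Z):=|Z|^{-1}\sum_{x\in Z}f(x)$; constraints written after the bar mean uniform averaging over all tuples satisfying them. All objects depend on a parameter $N$ ranging over a sequence tending to infinity while $J,d,H$ are fixed; implicit constants may depend on $J$. $o_{x\to0;y}(X)$ denotes a quantity bounded in magnitude by $c(x,y)X$ where $c(x,y)\to0$ as $x\to0$ for each fixed $y$; $O_y(X)$ a quantity bounded by $C(y)X$. Cube notation: for a finite set $e$, $\{0,1\}^e$ is the set of tuples $\omega=(\omega_j)_{j\in e}$ with $\omega_j\in\{0,1\}$, and $0^e$ is the all-zero tuple; for $x^{(0)}_J,x^{(1)}_J\in V_J$, $e\subseteq J$ and $\omega\in\{0,1\}^e$, set $x^{(\omega)}_e:=(x^{(\omega_j)}_j)_{j\in e}\in V_e$ and $x^{(a)}_e:=(x^{(a)}_j)_{j\in e}$ for $a\in\{0,1\}$. The Gowers cube norm of $f:V_e\to\mathbb{R}$ is $\|f\|_{\Box^e}:=\mathbb{E}\big(\prod_{\omega\in\{0,1\}^e}f(x^{(\omega)}_e)\mid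 x^{(0)}_e,x^{(1)}_e\in V_e\big)^{1/2^{|e|}}$. A system of measures is a family of functions $\nu_e:V_e\to[0,\infty)$, $e\in H$, with $\mathbb{E}(\nu_e(x_e)\mid x_e\in V_e)=1+o_{N\to\infty}(1)$. For $e\in H$ and $f:V_e\to\mathbb{R}$, $\mathcal{D}_ef(x^{(0)}_e):=\mathbb{E}\big(\prod_{\omega\in\{0,1\}^e,\ \omega\neq 0^e}f(x^{(\omega)}_e)\mid x^{(1)}_e\in V_e\big)$. The system is pseudorandom if: (i) $\mathcal{D}_e(\nu_e+1)(x_e)=O(1)$ for all $e\in H$, $x_e\in V_e$; (ii) for every choice of exponents $n_{e,\omega}\in\{0,1\}$, $\mathbb{E}\big(\prod_{e\in H}\prod_{\omega\in\{0,1\}^e}\nu_e(x^{(\omega)}_e)^{n_{e,\omega}}\mid x^{(0)}_J,x^{(1)}_J\in V_J\big)=1+o_{N\to\infty}(1)$; (iii) for every $e\in H$, $j\in e$, every choice of $n_{e,\omega}\in\{0,1\}$ and every integer $K\ge0$, $\mathbb{E}\Big(\mathbb{E}\big(\prod_{\omega\in\{0,1\}^e}\nu_e(x^{(\omega)}_e)^{n_{e,\omega}}\mid x^{(0)}_j,x^{(1)}_j\in V_j\big)^K\ \Big|\ x^{(0)}_{e\setminus\{j\}},x^{(1)}_{e\setminus\{j\}}\in V_{e\setminus\{j\}}\Big)=O_K(1)$. *)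

(* Defs.v *)
From HB Require Import structures.
From mathcomp Require Import all_boot all_order all_algebra.
From mathcomp Require Import all_classical all_reals all_analysis.
Set Implicit Arguments. Unset Strict Implicit. Unset Printing Implicit Defensive.
Import Order.TTheory GRing.Theory Num.Theory.
Import numFieldNormedType.Exports.
Local Open Scope classical_set_scope.
Local Open Scope ring_scope.

Section Defs.
Variable J : finType.

Definition sube (e : {set J}) := {i : J | i \in e}.

Definition Ve (V : J -> finType) (e : {set J}) : finType :=
  {dffun forall i : sube e, V (val i)}.

Definition VJ (V : J -> finType) : finType := {dffun forall j : J, V j}.

Definition restr (V : J -> finType) (e : {set J}) (x : VJ V) : Ve V e :=
  [ffun i : sube e => x (val i)].

Definition cube (V : J -> finType) (e : {set J}) (x0 x1 : Ve V e)
  (w : {ffun sube e -> bool}) : Ve V e :=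
  [ffun i : sube e => if w i then x1 i else x0 i].

Lemma sube_setD1 (e : {set J}) (j : J) (i : sube e) :
  val i <> j -> val i \in e :\ j.
Proof. by move=> h; rewrite in_setD1 (valP i) andbT; apply/eqP. Qed.

Definition glue_at (V : J -> finType) (e : {set J}) (j : J)
  (z : Ve V (e :\ j)) (y : V j) (i : sube e) : V (val i) :=
  match val i =P j with
  | ReflectT h => ecast k (V k) (esym h) y
  | ReflectF h => z (exist _ (val i) (sube_setD1 h))
  end.

Definition glue (V : J -> finType) (e : {set J}) (j : J)
  (z : Ve V (e :\ j)) (y : V j) : Ve V e :=
  [ffun i : sube e => glue_at z y i].
End Defs.

Section Avg.
Variable R : realType.

Definition avg (T : finType) (f : T -> R) : R :=
  (\sum_(x : T) f x) / #|T|%:R.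

Definition avg2 (T : finType) (f : T -> T -> R) : R :=
  avg (fun p : T * T => f p.1 p.2).

(* sigma-algebra on a finite set (countable unions reduce to finite ones) *)
Definition is_sigma_alg (T : finType) (B : {set {set T}}) : Prop :=
  [/\ finset.set0 \in B,
      forall A, A \in B -> ~: A \in B
    & forall A C, A \in B -> C \in B -> A :|: C \in B].

Definition atom (T : finType) (B : {set {set T}}) (x : T) : {set T} :=
  \bigcap_(A in B | x \in A) A.

Definition condE (T : finType) (B : {set {set T}}) (f : T -> R) (x : T) : R :=
  (\sum_(y in atom B x) f y) / #|atom B x|%:R.

Definition boxnorm (J : finType) (V : J -> finType) (e : {set J})
  (g : Ve V e -> R) : R :=
  (avg2 (fun x0 x1 : Ve V e =>
     \prod_(w : {ffun sube e -> bool}) g (cube x0 x1 w)))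
  `^ ((2 ^ #|e|)%:R)^-1.

Definition De (J : finType) (V : J -> finType) (e : {set J})
  (f : Ve V e -> R) (x0 : Ve V e) : R :=
  avg (fun x1 : Ve V e =>
     \prod_(w : {ffun sube e -> bool} | w != [ffun => false]) f (cube x0 x1 w)).

(* V = (J, (V_j), d, H) is a hypergraph system, for every value n of the
   parameter N *)
Definition hypergraph_system (J : finType) (d : nat) (H : {set {set J}})
  (V : nat -> J -> finType) : Prop :=
  [/\ (0 < d)%N, (forall e, e \in H -> #|e| = d)
    & forall n j, (0 < #|V n j|)%N].

Definition system_of_measures (J : finType) (H : {set {set J}})
  (V : nat -> J -> finType)
  (nu : forall n (e : {set J}), Ve (V n) e -> R) : Prop :=
  (forall n e x, e \in H -> 0 <= nu n e x) /\
  (forall e, e \in H -> avg (nu n e) @[n --> \oo] --> (1 : R)).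

Definition pseudorandom (J : finType) (H : {set {set J}})
  (V : nat -> J -> finType)
  (nu : forall n (e : {set J}), Ve (V n) e -> R) : Prop :=
  [/\ @system_of_measures J H V nu,
   (exists C : R, forall n e, e \in H -> forall x,
       `|De (fun y => nu n e y + 1) x| <= C),
   (forall expo : forall e : {set J}, {ffun sube e -> bool} -> bool,
     avg2 (fun x0 x1 : VJ (V n) =>
        \prod_(e in H) \prod_(w : {ffun sube e -> bool})
          (if expo e w then nu n e (cube (restr e x0) (restr e x1) w) else 1))
       @[n --> \oo] --> (1 : R))
   &
   (forall e j, e \in H -> j \in e ->
    forall (expo : {ffun sube e -> bool} -> bool) (K : nat),
    exists C : R, forall n,
      `| avg2 (fun z0 z1 : Ve (V n) (e :\ j) =>
           (avg2 (fun y0 y1 : V n j =>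
              \prod_(w : {ffun sube e -> bool})
                (if expo w then nu n e (cube (glue z0 y0) (glue z1 y1) w)
                 else 1))) ^+ K) | <= C)].
End Avg.
Arguments hypergraph_system {J} d H V.
Arguments pseudorandom {R J} H V nu.

(* Main.v *)
Require Import Defs.
From HB Require Import structures.
From mathcomp Require Import all_boot all_order all_algebra.
From mathcomp Require Import all_classical all_reals all_analysis.
From mathcomp Require Import ring lra.
Set Implicit Arguments. Unset Strict Implicit. Unset Printing Implicit Defensive.
Import Order.TTheory GRing.Theory Num.Theory.
Import numFieldNormedType.Exports.
Local Open Scope classical_set_scope.
Local Open Scope ring_scope.

(* The partition is generated by finitely many thresholds of dual functions D F
   with |F| <= nu + 1. As long as the normalised error g = (1 - 1_Om)(f - E(f|B))
   has large box norm, <g, D g> is large, so adjoining thresholds of D g to the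
   partition raises the energy E((1 - 1_Om) E(f|B)^2) by a fixed amount; since
   this energy is bounded, the process stops after O_eps(1) steps.

   E(nu|B) stays close to 1 outside the union Om of the atoms of small measure
   because nu - 1 correlates with no atom: thresholds are chosen such that little
   mass of nu + 1 lies near them, so the indicator of an atom is close in
   L^1(nu + 1) to a polynomial in boundedly many dual functions, and nu - 1 is
   almost orthogonal to products of dual functions. For the latter, apply
   Cauchy-Schwarz once in each coordinate j of e to <nu - 1, prod_k D F_k>,
   discarding each time the factors that do not depend on x_j; their moments are
   bounded by condition (iii). What remains is the box norm of nu - 1, which
   tends to 0 by condition (ii). *)

(** * Averages and conditional expectations on finite sets *)

(** The obstacle is that [nu] has no bound uniform in the parameter, so only averages weighted by
    [nu + 1] and the dual functions, bounded by condition (i), can be handled. Condition (iii) is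
    not uniform in its exponent, and the argument needs the exponent to be twice the number of dual
    functions multiplied together. That number must therefore be fixed before the parameter grows:
    the count of thresholds, the degree of the polynomials and the length of the iteration are
    computed from the bound on dual functions, [eps] and the accuracy [del] alone. This is why the
    structure theorem concerns an arbitrary finite set and an abstract class [D], with constants
    chosen first. An exceptional set is unavoidable: on an atom of tiny measure, a small correlation
    of [nu - 1] with its indicator says nothing about the average of [nu] there. The theorem works
    at a fixed accuracy [del]; the error tending to 0 is recovered at the end by a diagonal
    choice. *)

Section Average.
Variables (R : realType) (T : finType).
Implicit Types f g : T -> R.

Lemma eq_avg f g : f =1 g -> avg f = avg g.
Proof. by move=> fg; rewrite /avg (eq_bigr g). Qed.

Lemma avgD f g : avg (fun x => f x + g x) = avg f + avg g.
Proof. by rewrite /avg big_split /= mulrDl. Qed.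

Lemma avgN f : avg (fun x => - f x) = - avg f.
Proof. by rewrite /avg sumrN mulNr. Qed.

Lemma avgB f g : avg (fun x => f x - g x) = avg f - avg g.
Proof. by rewrite avgD avgN. Qed.

Lemma avgZl a f : avg (fun x => a * f x) = a * avg f.
Proof. by rewrite /avg -mulr_sumr mulrA. Qed.

Lemma avgZr a f : avg (fun x => f x * a) = avg f * a.
Proof. by rewrite /avg -mulr_suml -!mulrA [a * _]mulrC. Qed.

Lemma avg_sum (I : finType) (F : I -> T -> R) :
  avg (fun x => \sum_i F i x) = \sum_i avg (F i).
Proof. by rewrite /avg exchange_big /= mulr_suml. Qed.

Lemma ler_avg f g : (forall x, f x <= g x) -> avg f <= avg g.
Proof.
by move=> fg; rewrite /avg ler_wpM2r ?invr_ge0 ?ler0n// ler_sum.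
Qed.

Lemma avg_ge0 f : (forall x, 0 <= f x) -> 0 <= avg f.
Proof. by move=> f0; rewrite divr_ge0 ?ler0n// sumr_ge0. Qed.

Lemma ler_norm_avg f : `|avg f| <= avg (fun x => `|f x|).
Proof.
rewrite /avg normrM [`|_^-1|]ger0_norm ?invr_ge0 ?ler0n//.
by rewrite ler_wpM2r ?invr_ge0 ?ler0n// ler_norm_sum.
Qed.

Lemma avg_cst (a : R) : (0 < #|T|)%N -> avg (fun _ : T => a) = a.
Proof.
by move=> T0; rewrite /avg sumr_const -[_ *+ _]mulr_natr mulfK// pnatr_eq0 -lt0n.
Qed.

Lemma avg_bij (U : finType) (h : U -> T) f :
  bijective h -> avg (fun u => f (h u)) = avg f.
Proof.
move=> hb; rewrite /avg [in RHS](reindex h); last exact: onW_bij.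
by rewrite (bij_eq_card hb).
Qed.

Lemma avg_cauchy_schwarz f g :
  avg (fun x => f x * g x) ^+ 2
    <= avg (fun x => f x ^+ 2) * avg (fun x => g x ^+ 2).
Proof.
set a := avg (fun x => g x ^+ 2); set b := avg (fun x => f x * g x).
set c := avg (fun x => f x ^+ 2).
have a0 : 0 <= a by apply: avg_ge0 => x; exact: sqr_ge0.
have c0 : 0 <= c by apply: avg_ge0 => x; exact: sqr_ge0.
have quad s t : 0 <= s ^+ 2 * c + 2 * s * t * b + t ^+ 2 * a.
  have -> : s ^+ 2 * c + 2 * s * t * b + t ^+ 2 * a
      = avg (fun x => (s * f x + t * g x) ^+ 2).
    rewrite /a /b /c -!avgZl -!avgD; apply: eq_avg => x; ring.
  by apply: avg_ge0 => x; exact: sqr_ge0.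
(* When [a = 0], the choice [s = b], [t = - (c + 1) / 2] turns the quadratic form into
   [- b ^+ 2]. *)
have [a_eq0|a_neq0] := eqVneq a 0.
  have := quad b (- (c + 1) / 2).
  rewrite a_eq0 mulr0 addr0.
  have -> : b ^+ 2 * c + 2 * b * (- (c + 1) / 2) * b = - b ^+ 2 by field.
  by rewrite mulr0 oppr_ge0.
have a_gt0 : 0 < a by rewrite lt_def a_neq0.
have := quad a (- b).
have -> : a ^+ 2 * c + 2 * a * - b * b + (- b) ^+ 2 * a = a * (c * a - b ^+ 2)
  by ring.
by rewrite pmulr_rge0// subr_ge0.
Qed.

End Average.

Lemma avg_exchange (R : realType) (T U : finType) (F : T -> U -> R) :
  avg (fun x => avg (F x)) = avg (fun y => avg (F^~ y)).
Proof.
rewrite /avg.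
under eq_bigr do rewrite mulr_suml.
under [in RHS]eq_bigr do rewrite mulr_suml.
rewrite exchange_big /= !mulr_suml; apply: eq_bigr => y _.
by rewrite !mulr_suml; apply: eq_bigr => x _; rewrite mulrAC.
Qed.

Lemma avg_pair (R : realType) (T U : finType) (F : T -> U -> R) :
  avg (fun p : T * U => F p.1 p.2) = avg (fun x => avg (F x)).
Proof.
rewrite /avg card_prod natrM invfM mulrA -(pair_bigA _ F) /=.
rewrite !mulr_suml; apply: eq_bigr => x _; ring.
Qed.

(** Independence of coordinates. It lets a product of several dual functions be written as one
    average in which each has its own copy of the doubled variable. *)
Lemma avg_ffun_prod (R : realType) (I T : finType) (a : I -> T -> R) :
  avg (fun z : {ffun I -> T} => \prod_k a k (z k)) = \prod_k avg (a k).
Proof.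
rewrite /avg big_split /= bigA_distr_bigA /= card_ffun; congr (_ * _).
by rewrite prodr_const natrX exprVn.
Qed.

Section ConditionalExpectation.
Variables (R : realType) (T : finType) (P : eqType) (lam : T -> P).
Implicit Types f g : T -> R.

(** Partitions are carried as labellings [lam], not as set systems: refining is then pairing labels,
    and the number of labels bounds the number of atoms. The sigma-algebra is built only at the very
    end. *)
Definition fibre (x : T) : {set T} := [set y | lam y == lam x].

Definition fibre_avg f x : R := (\sum_(y in fibre x) f y) / #|fibre x|%:R.

Definition fibre_constant f := forall x y, lam x = lam y -> f x = f y.

Lemma fibre_refl x : x \in fibre x.
Proof. by rewrite inE. Qed.

Lemma fibre_sym x y : (x \in fibre y) = (y \in fibre x).
Proof. by rewrite !inE eq_sym. Qed.

Lemma card_fibre_gt0 x : (0 < #|fibre x|)%N.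
Proof. by apply/card_gt0P; exists x; exact: fibre_refl. Qed.

Lemma natr_fibre_neq0 x : #|fibre x|%:R != 0 :> R.
Proof. by rewrite pnatr_eq0 -lt0n card_fibre_gt0. Qed.

Lemma eq_fibre x y : lam x = lam y -> fibre x = fibre y.
Proof. by move=> xy; apply/setP => z; rewrite !inE xy. Qed.

Lemma fibre_avg_fibre_constant f : fibre_constant (fibre_avg f).
Proof. by move=> x y /eq_fibre xy; rewrite /fibre_avg xy. Qed.

Lemma fibre_avg_bounds a b f x :
  (forall y, lam y = lam x -> a <= f y <= b) -> a <= fibre_avg f x <= b.
Proof.
move=> fab; have n0 : 0 < #|fibre x|%:R :> R by rewrite ltr0n card_fibre_gt0.
rewrite ler_pdivlMr// ler_pdivrMr// !mulr_natr -!sumr_const.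
apply/andP; split; apply: ler_sum => y; rewrite inE => /eqP /fab /andP[] //.
Qed.

Lemma ler_fibre_avg f g x :
  (forall y, f y <= g y) -> fibre_avg f x <= fibre_avg g x.
Proof.
by move=> fg; rewrite /fibre_avg ler_wpM2r ?invr_ge0 ?ler0n// ler_sum.
Qed.

(** Conditional expectation is self-adjoint and fixes fibre-constant functions. After exchanging the
    sums, each [f y] is counted once per point of its fibre, which cancels the denominator. *)
Lemma avg_fibre_avg f g :
  fibre_constant g -> avg (fun x => g x * fibre_avg f x) = avg (fun x => g x * f x).
Proof.
move=> gm; rewrite /avg; congr (_ / _).
transitivity (\sum_x \sum_(y in fibre x) g x * f y / #|fibre x|%:R).
  by apply: eq_bigr => x _; rewrite -mulr_suml -mulr_sumr mulrA.
rewrite (exchange_big_dep predT) //=; apply: eq_bigr => y _.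
transitivity (\sum_(x in fibre y) g y * f y / #|fibre y|%:R).
  apply: eq_big => [x|x]; first by rewrite fibre_sym.
  rewrite inE => /eqP yx; rewrite (eq_fibre yx) (gm _ _ yx) //.
by rewrite sumr_const -[LHS]mulr_natr divfK// natr_fibre_neq0.
Qed.

End ConditionalExpectation.

(** * Functions controlled by products of dual functions *)

Section Tame.
Variables (R : realType) (T : finType) (D : (T -> R) -> Prop).
Hypothesis D1 : D (fun=> 1).

(* [g] behaves, when tested against any [phi], as a linear combination of
   products of [M] elements of [D] whose coefficients have total mass [L];
   defining this by duality makes closure under products a two-step test. *)
Definition tame (M : nat) (L : R) (g : T -> R) := forall (phi : T -> R) (del : R),
  (forall G : 'I_M -> T -> R, (forall k, D (G k)) ->
     `|avg (fun x => phi x * \prod_k G k x)| <= del) ->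
  `|avg (fun x => phi x * g x)| <= L * del.

Lemma eq_tame M L g g' : g =1 g' -> tame M L g -> tame M L g'.
Proof. by move=> /funext ->. Qed.

Lemma tame_test_ge0 M (phi : T -> R) (del : R) :
  (forall G : 'I_M -> T -> R, (forall k, D (G k)) ->
     `|avg (fun x => phi x * \prod_k G k x)| <= del) -> 0 <= del.
Proof. by move=> /(_ (fun _ _ => 1) (fun=> D1)); apply: le_trans. Qed.

Lemma tame_le M L L' g : L <= L' -> tame M L g -> tame M L' g.
Proof.
move=> LL' tg phi del h; apply: le_trans (tg _ _ h) _.
by rewrite ler_wpM2r// (tame_test_ge0 h).
Qed.

Lemma tame_cst M a : tame M `|a| (fun=> a).
Proof.
move=> phi del h; rewrite avgZr normrM mulrC ler_wpM2l//.
have := h (fun _ _ => 1) (fun=> D1); congr (`|_| <= _).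
by apply: eq_avg => x; rewrite big1// mulr1.
Qed.

Lemma tame_gen G : D G -> tame 1 1 G.
Proof.
move=> DG phi del h; rewrite mul1r.
have := h (fun _ => G) (fun=> DG); congr (`|_| <= _).
by apply: eq_avg => x; rewrite big_ord1.
Qed.

Lemma tameM M M' (L L' : R) g g' : 0 <= L' -> tame M L g -> tame M' L' g' ->
  tame (M + M') (L * L') (fun x => g x * g' x).
Proof.
move=> L'0 tg tg' phi del h.
have -> : avg (fun x => phi x * (g x * g' x)) = avg (fun x => phi x * g' x * g x).
  by apply: eq_avg => x; ring.
(* [g] is tested against [phi * g'] at level [L' * del]; each such test is in turn a test of [g']
   against [phi] times the first product. *)
rewrite -mulrA; apply: tg => G DG.
have -> : avg (fun x => phi x * g' x * \prod_k G k x)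
  = avg (fun x => phi x * \prod_k G k x * g' x) by apply: eq_avg => x; ring.
apply: tg' => G' DG'.
pose GG (k : 'I_(M + M')) := match fintype.split k with inl i => G i | inr j => G' j end.
have := h GG; have -> : avg (fun x => phi x * \prod_(k < M + M') GG k x)
  = avg (fun x => phi x * (\prod_k G k x) * \prod_k G' k x).
  apply: eq_avg => x; rewrite big_split_ord /= -mulrA; congr (_ * (_ * _)).
    by apply: eq_bigr => k _; rewrite /GG (unsplitK (inl k)).
  by apply: eq_bigr => k _; rewrite /GG (unsplitK (inr k)).
apply=> k; rewrite /GG; case: fintype.split => ?; [exact: DG|exact: DG'].
Qed.

(** The missing factors are filled with the constant 1. This brings all approximants to one common
    length, the only one for which non-correlation is assumed. *)
Lemma tame_weaken M M' L g : (M <= M')%N -> tame M L g -> tame M' L g.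
Proof.
move=> MM' tg; rewrite -(subnKC MM') -[L]mulr1.
apply: (@eq_tame _ _ (fun x => g x * 1)); first by move=> x; rewrite mulr1.
by apply: tameM => //; have := @tame_cst (M' - M) 1; rewrite normr1.
Qed.

Lemma tameD M L L' g g' : tame M L g -> tame M L' g' ->
  tame M (L + L') (fun x => g x + g' x).
Proof.
move=> tg tg' phi del h; rewrite mulrDl.
have -> : avg (fun x => phi x * (g x + g' x))
  = avg (fun x => phi x * g x) + avg (fun x => phi x * g' x).
  by rewrite -avgD; apply: eq_avg => x; rewrite mulrDr.
by apply: le_trans (ler_normD _ _) _; rewrite lerD// ?tg ?tg'.
Qed.

Lemma tameZ M L a g : tame M L g -> tame M (`|a| * L) (fun x => a * g x).
Proof.
move=> tg phi del h.
have -> : avg (fun x => phi x * (a * g x)) = a * avg (fun x => phi x * g x).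
  by rewrite -avgZl; apply: eq_avg => x; rewrite mulrCA.
by rewrite normrM -mulrA ler_wpM2l// tg.
Qed.

Lemma tame1B M L g : tame M L g -> tame M (1 + L) (fun x => 1 - g x).
Proof.
move=> tg; apply: tameD; first by have := @tame_cst M 1; rewrite normr1.
apply: (@eq_tame _ _ (fun x => -1 * g x)); first by move=> x; rewrite mulN1r.
by have := tameZ (-1) tg; rewrite normrN1 mul1r.
Qed.

Lemma tameX M L g n : 0 <= L -> tame M L g ->
  tame (M * n) (L ^+ n) (fun x => g x ^+ n).
Proof.
move=> L0 tg; elim: n => [|n IHn].
  by rewrite muln0 expr0; have := @tame_cst 0 1; rewrite normr1.
rewrite mulnS exprS.
apply: (@eq_tame _ _ (fun x => g x * g x ^+ n)); first by move=> x; rewrite exprS.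
by apply: tameM => //; exact: exprn_ge0.
Qed.

End Tame.

(** * Polynomial approximation of thresholds *)

Section Step.
Variable R : realType.

Lemma bernoulli (x : R) n : -1 <= x -> 1 + n%:R * x <= (1 + x) ^+ n.
Proof.
move=> x1; elim: n => [|n IHn]; first by rewrite mul0r addr0 expr0.
have n0 : 0 <= n%:R :> R by exact: ler0n.
rewrite exprS -natr1; apply: le_trans (_ : (1 + x) * (1 + n%:R * x) <= _).
  have := mulr_ge0 n0 (sqr_ge0 x); lra.
by apply: ler_wpM2l => //; lra.
Qed.

(* On [0, 1] this tends to the indicator of [u < 1/2], at a rate that follows
   from Bernoulli's inequality alone. *)
Definition step_poly (m : nat) (u : R) : R := (1 - u ^+ m) ^+ (2 ^ m).

Lemma step_poly_itv m u : 0 <= u <= 1 -> 0 <= step_poly m u <= 1.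
Proof.
case/andP=> u0 u1; have um0 := exprn_ge0 m u0; have um1 := exprn_ile1 m u0 u1.
by rewrite /step_poly exprn_ge0 ?exprn_ile1 ?subr_ge0// gerBl.
Qed.

(** Bernoulli twice: [step_poly m u] is at least [1 - (2 * u) ^+ m], and [2 * u * (1 + x) <= 1]
    gives [(2 * u) ^+ m <= (1 + x) ^- m], which is at most the claimed bound. *)
Lemma step_poly_small m u x : 0 <= x -> 0 <= u <= 1 -> 2 * u <= 1 - x ->
  1 - step_poly m u <= (1 + m%:R * x)^-1.
Proof.
move=> x0 /andP[u0 u1] ux.
have um1 := exprn_ile1 m u0 u1.
have mx : 0 < 1 + m%:R * x by rewrite ltr_wpDr// mulr_ge0// ler0n.
have B : 1 - (2 * u) ^+ m <= step_poly m u.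
  have /(@bernoulli _ (2 ^ m)) : -1 <= - u ^+ m by rewrite lerN2.
  by rewrite natrX mulrN -exprMn.
rewrite -[leRHS]mul1r ler_pdivlMr//.
suff : (2 * u) ^+ m * (1 + m%:R * x) <= 1.
  move: B; set s := step_poly m u; set v := (2 * u) ^+ m => B h.
  have : (1 - s) * (1 + m%:R * x) <= v * (1 + m%:R * x).
    by rewrite ler_pM2r//; lra.
  lra.
have /(@bernoulli _ m) Bx : -1 <= x by lra.
have : (2 * u) ^+ m * (1 + x) ^+ m <= 1.
  rewrite -exprMn exprn_ile1//; first by rewrite mulr_ge0//; lra.
  have : (2 * u) * (1 + x) <= (1 - x) * (1 + x) by rewrite ler_wpM2r//; lra.
  have := sqr_ge0 x; lra.
apply: le_trans; rewrite ler_wpM2l// exprn_ge0//; lra.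
Qed.

(** With [v = u ^+ m], the product of the [2 ^ m]-th powers of [1 - v] and [1 + v] is at most 1,
    while Bernoulli bounds the second power below by [(2 * u) ^+ m], hence by [1 + m%:R * x]. *)
Lemma step_poly_large m u x : 0 <= x -> 0 <= u <= 1 -> 1 + x <= 2 * u ->
  step_poly m u <= (1 + m%:R * x)^-1.
Proof.
move=> x0 /andP[u0 u1] ux.
have um0 := exprn_ge0 m u0; have um1 := exprn_ile1 m u0 u1.
have mx : 0 < 1 + m%:R * x by rewrite ltr_wpDr// mulr_ge0// ler0n.
have /(@step_poly_itv m) /andP[s0 s1] : 0 <= u <= 1 by rewrite u0.
rewrite -[leRHS]mul1r ler_pdivlMr//.
apply: le_trans (_ : (1 - u ^+ m) ^+ (2 ^ m) * (1 + u ^+ m) ^+ (2 ^ m) <= _).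
  apply: ler_wpM2l => //.
  have /(@bernoulli _ m) Bx : -1 <= x by lra.
  have /(@bernoulli _ (2 ^ m)) : -1 <= u ^+ m by lra.
  apply: le_trans; apply: le_trans Bx _.
  rewrite natrX -exprMn; apply: le_trans (_ : (2 * u) ^+ m <= _).
    by rewrite lerXn2r// nnegrE; lra.
  by rewrite lerDr.
rewrite -exprMn exprn_ile1// ?mulr_ge0//; [lra|lra|].
have := sqr_ge0 (u ^+ m); lra.
Qed.

Lemma tame_step_poly (T : finType) (D : (T -> R) -> Prop) m L u :
  D (fun=> 1) -> 0 <= L -> tame D 1 L u ->
  tame D (m * 2 ^ m) ((1 + L ^+ m) ^+ (2 ^ m)) (fun x => step_poly m (u x)).
Proof.
move=> D1 L0 tu; apply: tameX => //; first by rewrite addr_ge0// exprn_ge0.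
by apply: tame1B => //; rewrite -[X in tame _ X]mul1n; exact: tameX.
Qed.

Lemma exclusive_sum_le1 n (c : 'I_n -> bool) :
  (forall i j, c i -> c j -> i = j) -> \sum_i (c i)%:R <= 1 :> R.
Proof.
move=> cu; case: (pickP c) => [i ci|c0].
  rewrite (bigD1 i)//= ci big1 ?addr0// => j ji.
  by case: (boolP (c j)) => // cj; rewrite (cu _ _ ci cj) eqxx in ji.
by rewrite big1// => i _; rewrite c0.
Qed.

(* Pigeonhole: the neighbourhoods of [q] equally spaced candidates are disjoint. *)
Lemma exists_threshold (T : finType) (w G : T -> R) (t0 s b : R) (q : nat) :
  (0 < q)%N -> 0 < s -> (forall x, 0 <= w x) -> avg w <= b ->
  exists t, [/\ t0 <= t, t <= t0 + s
    & avg (fun x => w x * (`|G x - t| < s / q%:R / 2)%R%:R) <= b / q%:R].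
Proof.
move=> q0 s0 w0 wb; have q0' : 0 < q%:R :> R by rewrite ltr0n.
pose t (a : 'I_q) := t0 + s * (a%:R / q%:R).
suff [a ha] : exists a : 'I_q,
    avg (fun x => w x * (`|G x - t a| < s / q%:R / 2)%R%:R) <= b / q%:R.
  exists (t a); split=> //.
    by rewrite lerDl mulr_ge0 ?divr_ge0 ?ler0n// ltW.
  by rewrite lerD2l ler_piMr ?(ltW s0)// ler_pdivrMr// mul1r ler_nat ltnW.
apply: contrapT => /forallNP nh.
have : \sum_(a < q) b / q%:R <
    \sum_(a < q) avg (fun x => w x * (`|G x - t a| < s / q%:R / 2)%R%:R).
  apply: ltr_sum; first by apply/hasP; exists (Ordinal q0); rewrite ?mem_index_enum.
  by move=> a _; rewrite ltNge; apply/negP; exact: nh.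
rewrite sumr_const card_ord -[X in X < _]mulr_natr divfK ?gt_eqF//.
rewrite -avg_sum; apply/negP; rewrite -leNgt; apply: le_trans wb.
apply: ler_avg => x; rewrite -mulr_sumr ler_piMr//.
apply: exclusive_sum_le1 => i j hi hj; apply: contrapT => /eqP ij.
have : `|t i - t j| < s / q%:R.
  have := ler_distD (G x) (t i) (t j); rewrite (distrC (t i) (G x)); lra.
apply/negP; rewrite -leNgt.
have -> : t i - t j = s / q%:R * (i%:R - j%:R) by rewrite /t; field; rewrite gt_eqF.
rewrite normrM gtr0_norm ?divr_gt0// ler_pMr ?divr_gt0//.
have [ji|ij'] := leqP j i.
  rewrite -natrB// normr_nat ler1n subn_gt0 ltn_neqAle ji andbT.
  by rewrite eq_sym.
by rewrite distrC -natrB ?(ltnW ij')// normr_nat ler1n subn_gt0.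
Qed.

End Step.

Section Structured.
Variables (R : realType) (T : finType) (D : (T -> R) -> Prop) (w : T -> R).
Hypotheses (D1 : D (fun=> 1)) (w0 : forall x, 0 <= w x).

(** The range condition on [g] makes the errors add, instead of being amplified, when indicators are
    multiplied. The weight [w] will be [nu + 1], which dominates [nu - 1] in absolute value. *)
Definition structured (M : nat) (L kap : R) (P : finType) (lam : T -> P) :=
  forall p, exists g, [/\ tame D M L g, forall x, 0 <= g x <= 1
    & avg (fun x => w x * `|(lam x == p)%:R - g x|) <= kap].

(** The indicator of an intersection is approximated by the product of the approximants; the error
    telescopes, one factor being exchanged at a time. *)
Lemma structured_pair M L kap M' L' kap' (P Q : finType) (lam : T -> P)
    (mu : T -> Q) : 0 <= L' ->
  structured M L kap lam -> structured M' L' kap' mu ->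
  structured (M + M') (L * L') (kap + kap') (fun x => (lam x, mu x)).
Proof.
move=> L'0 sl sm [p q]; have [g [tg g01 gw]] := sl p.
have [h [th h01 hw]] := sm q.
exists (fun x => g x * h x); split; first exact: tameM.
  by move=> x; have /andP[? ?] := g01 x; have /andP[? ?] := h01 x;
    rewrite mulr_ge0//= mulr_ile1.
apply: le_trans (lerD gw hw); rewrite -avgD; apply: ler_avg => x.
rewrite -mulrDr ler_wpM2l// xpair_eqE.
have /andP[g0 g1] := g01 x; have /andP[h0 h1] := h01 x.
have -> : (((lam x == p) && (mu x == q))%:R - g x * h x : R)
  = (mu x == q)%:R * ((lam x == p)%:R - g x)
    + g x * ((mu x == q)%:R - h x).
  by case: (lam x == p); case: (mu x == q) => /=; ring.
apply: le_trans (ler_normD _ _) _; rewrite !normrM lerD//.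
  by rewrite ler_piMl// normr_nat lern1; case: (_ == _).
by rewrite ler_piMl// ger0_norm.
Qed.

End Structured.

(** Half of [kap] pays for the points near the threshold, where only their mass is small, and half
    for the others, where the step polynomial is accurate. Both [M] and [L] precede [T], as the
    later choice of constants requires; 3 will bound the average of [nu + 1]. *)
Lemma structured_threshold (R : realType) (C s kap : R) :
  1 <= C -> 0 < s -> 0 < kap ->
  exists M L, 1 <= L /\
  forall (T : finType) (D : (T -> R) -> Prop) (w : T -> R),
  D (fun=> 1) -> (forall x, 0 <= w x) -> avg w <= 3 ->
  forall G, D G -> (forall x, `|G x| <= C) ->
  forall t0, - C <= t0 -> t0 + s <= 2 * C ->
  exists t, [/\ t0 <= t, t <= t0 + s
    & structured D w M L kap (fun x => t <= G x)].
Proof.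
move=> C1 s0 kap0.
have [q q0 hq] : exists2 q : nat, (0 < q)%N & 3 / q%:R <= kap / 2.
  exists (Num.truncn (6 / kap)).+1 => //.
  rewrite ler_pdivrMr ?ltr0n// mulrAC ler_pdivlMr//.
  have := truncnS_gt (6 / kap); rewrite ltr_pdivrMr// mulrC; lra.
have q0' : 0 < q%:R :> R by rewrite ltr0n.
(* The half-width of the avoided neighbourhood, in the scale where
   [2 * u = 1 - (G - t) / (3 * C)]. *)
set x := s / q%:R / 2 / (3 * C).
have C0 : 0 < 3 * C by lra.
have x0 : 0 < x by rewrite !divr_gt0.
have [m hm] : exists m : nat, 3 / (1 + m%:R * x) <= kap / 2.
  exists (Num.truncn (6 / kap / x)).+1.
  set m := (Num.truncn _).+1; have mx : 6 / kap / x < m%:R by rewrite /m truncnS_gt.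
  move: mx; rewrite ltr_pdivrMr// ltr_pdivrMr// => mx.
  have mx0 : 0 < 1 + m%:R * x by rewrite ltr_wpDr// mulr_ge0 ?ler0n// ltW.
  rewrite ler_pdivrMr// mulrAC ler_pdivlMr//; lra.
set L := (1 + (1 : R) ^+ m) ^+ (2 ^ m).
have L0 : 0 <= L by rewrite exprn_ge0// addr_ge0// exprn_ge0.
exists (m * 2 ^ m)%N, (1 + L); split; first by rewrite lerDl.
move=> T D w D1 w0 w3 G DG GC t0 t0C t0s.
have [t [t0t tt0 tw]] := exists_threshold G t0 q0 s0 w0 w3.
exists t; split=> //.
(* Since [t] lies in [[-C, 2 * C]] and [G] in [[-C, C]], [t - G] is at most [3 * C] in absolute
   value; the affine map sends the threshold to [1 / 2]. *)
pose u y := 1 / 2 + (t - G y) / (6 * C).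
have u01 y : 0 <= u y <= 1.
  have := GC y; rewrite ler_norml => /andP[G1 G2].
  have h : - (1 / 2) <= (t - G y) / (6 * C) <= 1 / 2.
    by rewrite ler_pdivlMr ?ler_pdivrMr; lra.
  by rewrite /u; lra.
(* The coefficient mass is [1 / 2 + (t + 1) / (6 * C)], which is at most 1 because [t <= 2 * C] and
   [1 <= C]. *)
have tu : tame D 1 1 u.
  apply: (@tame_le _ _ _ D1 _
    (`|1 / 2 + t / (6 * C)| + `|- (6 * C)^-1| * 1)).
    rewrite mulr1 normrN !ger0_norm ?invr_ge0; last 2 first.
    - lra.
    - suff : - (1 / 2) <= t / (6 * C) by lra.
      by rewrite ler_pdivlMr; lra.
    suff : t / (6 * C) + 1 / (6 * C) <= 1 / 2 by lra.
    by rewrite -mulrDl ler_pdivrMr; lra.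
  apply: (@eq_tame _ _ _ _ _
     (fun y => (1 / 2 + t / (6 * C)) + - (6 * C)^-1 * G y)).
    by move=> y; rewrite /u; field; lra.
  by apply: tameD; [exact: tame_cst|apply: tameZ; exact: tame_gen].
pose h y := step_poly m (u y).
have th : tame D (m * 2 ^ m) L h by exact: tame_step_poly.
have h01 y : 0 <= h y <= 1 by exact: step_poly_itv.
have hw : avg (fun y => w y * `|(t <= G y)%R%:R - h y|) <= kap.
  pose near y := `|G y - t| < s / q%:R / 2.
  apply: le_trans (_ : avg (fun y => w y * (near y)%:R
     + w y * (1 + m%:R * x)^-1) <= _); last first.
    rewrite avgD avgZr.
    have : avg w * (1 + m%:R * x)^-1 <= 3 * (1 + m%:R * x)^-1.
      by rewrite ler_wpM2r// invr_ge0 addr_ge0// mulr_ge0 ?ler0n// ltW.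
    by move: tw hq hm; lra.
  apply: ler_avg => y; rewrite -mulrDr ler_wpM2l//.
  have inv0 : 0 <= (1 + m%:R * x)^-1 :> R.
    by rewrite invr_ge0 addr_ge0// mulr_ge0 ?ler0n// ltW.
  have := h01 y => /andP[hy0 hy1].
  case: (boolP (near y)) => /= [_|].
    suff : `|(t <= G y)%R%:R - h y| <= 1 by lra.
    by rewrite ler_norml; case: (t <= G y) => /=; lra.
  rewrite -leNgt add0r => far.
  have ux : 2 * u y = 1 - (G y - t) / (3 * C) by rewrite /u; field; lra.
  have [tG|Gt] := leP t (G y) => /=.
    rewrite ger0_norm ?subr_ge0//.
    apply: step_poly_small => //; first exact: ltW.
    rewrite ux lerD2l lerN2 /x ler_pM2r ?invr_gt0//.
    by move: far; rewrite ger0_norm ?subr_ge0.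
  rewrite sub0r normrN ger0_norm//.
  apply: step_poly_large => //; first exact: ltW.
  rewrite ux lerD2l -mulNr /x ler_pM2r ?invr_gt0//.
  by move: far; rewrite ltr0_norm ?subr_lt0.
case.
  exists h; split=> //; first by apply: tame_le th => //; rewrite lerDr.
  by under eq_avg do rewrite eqb_id.
exists (fun y => 1 - h y); split.
- exact: tame1B.
- by move=> y; have := h01 y; lra.
under eq_avg => y.
  have -> : `|((t <= G y) == false)%:R - (1 - h y)| = `|(t <= G y)%R%:R - h y|.
    by rewrite distrC; case: (t <= G y) => /=; congr `|_|; ring.
  over.
exact: hw.
Qed.

(** * The energy increment *)

Section Refinement.
Variables (R : realType) (T : finType) (D : (T -> R) -> Prop) (w : T -> R).
Hypotheses (D1 : D (fun=> 1)) (w0 : forall x, 0 <= w x).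

Lemma structured_le M M' (L L' kap kap' : R) (P : finType) (lam : T -> P) :
  (M <= M')%N -> L <= L' -> kap <= kap' ->
  structured D w M L kap lam -> structured D w M' L' kap' lam.
Proof.
move=> MM LL kk sl p; have [g [tg g01 gw]] := sl p; exists g; split=> //.
  by apply: tame_le LL _ => //; exact: tame_weaken tg.
exact: le_trans kk.
Qed.

Lemma structured_trivial (kap : R) : 0 <= kap -> structured D w 0 1 kap (fun=> tt).
Proof.
move=> kap0 [] /=; exists (fun=> 1); split.
- by have := @tame_cst _ _ _ D1 0 1; rewrite normr1.
- by move=> _; rewrite ler01 lexx.
- by under eq_avg do rewrite subrr normr0 mulr0; rewrite /avg big1// mul0r.
Qed.

Definition refines (P Q : eqType) (lam : T -> P) (mu : T -> Q) :=
  forall x y, mu x = mu y -> lam x = lam y.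

(** One threshold is chosen in each of [r] consecutive intervals of length [s] starting at [-C].
    Values of [G] more than [2 * s] apart have a whole interval between them, so some threshold
    separates them. *)
Lemma refine_by_thresholds M1 (L1 kap1 C s : R) (r : nat) :
  0 <= L1 -> 0 < s -> r%:R * s <= 2 * C + s -> s <= C -> 2 * C < r%:R * s ->
  forall G : T -> R, (forall x, `|G x| <= C) ->
  (forall t0 : R, - C <= t0 -> t0 + s <= 2 * C ->
    exists t : R, [/\ t0 <= t, t <= t0 + s
      & structured D w M1 L1 kap1 (fun x => t <= G x)]) ->
  forall M L kap (P : finType) (lam : T -> P), structured D w M L kap lam ->
  exists (Q : finType) (mu : T -> Q),
    [/\ #|Q| = (#|P| * 2 ^ r)%N,
        structured D w (M + M1 * r) (L * L1 ^+ r) (kap + r%:R * kap1) mu,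
        refines lam mu & forall x y, mu x = mu y -> `|G x - G y| <= 2 * s].
Proof.
move=> L10 s0 rs sC rs' G GC thr M L kap P lam slam.
suff H i : (i <= r)%N -> exists (Q : finType) (mu : T -> Q),
    [/\ #|Q| = (#|P| * 2 ^ i)%N,
        structured D w (M + M1 * i) (L * L1 ^+ i) (kap + i%:R * kap1) mu,
        refines lam mu & forall k, (k < i)%N ->
          exists t, [/\ - C + k%:R * s <= t, t <= - C + k%:R * s + s
          & forall x y, mu x = mu y -> (t <= G x) = (t <= G y)]].
  have [Q [mu [cQ smu ref mut]]] := H r (leqnn r).
  exists Q, mu; split=> //.
  have far x y : mu x = mu y -> G y - G x <= 2 * s.
    move=> xy; rewrite leNgt; apply/negP => xy_far.
    have /andP[Gx1 Gx2] : - C <= G x <= C by rewrite -ler_norml.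
    have /andP[Gy1 Gy2] : - C <= G y <= C by rewrite -ler_norml.
    (* The first interval lying entirely above [G x]; it ends at most [2 * s] above [G x], hence
       below [G y]. *)
    pose k := (Num.truncn ((G x + C) / s)).+1.
    have q0 : 0 <= (G x + C) / s by rewrite divr_ge0 ?(ltW s0)//; lra.
    have /andP[] := truncn_itv q0; rewrite ler_pdivlMr// ltr_pdivrMr// => k1 k2.
    have kE : k%:R * s = (Num.truncn ((G x + C) / s))%:R * s + s.
      by rewrite /k -natr1 mulrDl mul1r.
    have kr : (k < r)%N by rewrite -(ltr_nat R) -(ltr_pM2r s0); lra.
    have [t [t1 t2 /(_ _ _ xy)]] := mut k kr.
    have -> : t <= G y by lra.
    have -> : (t <= G x) = false by apply/negbTE; rewrite -ltNge; move: k2; rewrite -/k; lra.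
    by [].
  by move=> x y xy; rewrite ler_norml; have := far _ _ xy;
    have := far _ _ (esym xy); lra.
elim: i => [_|i IHi ir].
  exists P, lam; split=> //; first by rewrite expn0 muln1.
  by rewrite muln0 addn0 expr0 mulr1 mul0r addr0.
have [Q [mu [cQ smu ref mut]]] := IHi (ltnW ir).
have iC : i.+1%:R * s <= r%:R * s by rewrite ler_pM2r// ler_nat.
have i0 : 0 <= i%:R * s by rewrite mulr_ge0 ?ler0n// ltW.
have [||t [t1 t2 st]] := thr (- C + i%:R * s).
- by lra.
- by move: iC; rewrite -natr1 mulrDl mul1r; lra.
exists (Q * bool)%type, (fun x => (mu x, t <= G x)); split.
- by rewrite card_prod card_bool cQ expnSr mulnA.
- have := structured_pair w0 L10 smu st.
  rewrite mulnS [(M1 + _)%N]addnC addnA exprSr mulrA.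
  by rewrite -natr1 mulrDl mul1r addrA; apply.
- by move=> x y [/ref].
move=> k; rewrite ltnS leq_eqVlt => /predU1P[->|/mut [u [u1 u2 um]]].
  by exists t; split=> // x y [].
by exists u; split=> // x y [/um].
Qed.

End Refinement.

(** * The exceptional set *)

Section Exceptional.
Variables (R : realType) (T : finType) (nu : T -> R) (tau err : R).
Hypotheses (T0 : (0 < #|T|)%N) (tau0 : 0 < tau).
Variables (P : finType) (lam : T -> P).
Hypothesis nu_err :
  forall p, `|avg (fun x => (lam x == p)%:R * (nu x - 1))| <= err.

Definition small_fibres : {set T} :=
  [set x | #|fibre lam x|%:R <= tau * #|T|%:R].

Let T0' : 0 < #|T|%:R :> R. Proof. by rewrite ltr0n. Qed.

Lemma avg_fibre_indicator (h : T -> R) x :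
  avg (fun y => (lam y == lam x)%:R * h y)
    = (\sum_(y in fibre lam x) h y) / #|T|%:R.
Proof.
rewrite /avg [in RHS]big_mkcond; congr (_ / _); apply: eq_bigr => y _.
by rewrite inE; case: (_ == _); rewrite ?mul1r ?mul0r.
Qed.

(** On one small fibre, [nu + 1 = (nu - 1) + 2] has mass at most [err + 2 * tau]; summing over
    labels gives the factor [#|P|]. *)
Lemma small_fibres_mass : (forall x, 0 <= nu x) ->
  avg (fun x => (x \in small_fibres)%:R * (nu x + 1))
    <= #|P|%:R * (2 * tau + err).
Proof.
move=> nu0.
have -> : avg (fun x => (x \in small_fibres)%:R * (nu x + 1))
  = \sum_p avg (fun x => (lam x == p)%:R
      * ((x \in small_fibres)%:R * (nu x + 1))).
  rewrite -avg_sum; apply: eq_avg => x.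
  rewrite -mulr_suml (bigD1 (lam x))//= eqxx big1 ?addr0 ?mul1r//.
  by move=> p; rewrite eq_sym => /negbTE ->.
have err0 : 0 <= err.
  by have /card_gt0P[x _] := T0; apply: le_trans (nu_err (lam x)).
rewrite mulr_natl -sumr_const; apply: ler_sum => p _.
have [[x /andP[/eqP <- xS]]|none] :=
    pselect (exists x, (lam x == p) && (x \in small_fibres)); last first.
  rewrite /avg big1 ?mul0r; first by rewrite addr_ge0// mulr_ge0// ltW.
  move=> x _; case: eqVneq => [xp|]; last by rewrite mul0r.
  case: (boolP (x \in _)) => xS; last by rewrite mul0r mulr0.
  by case: none; exists x; rewrite xp eqxx.
apply: le_trans (_ : avg (fun y => (lam y == lam x)%:R * (nu y - 1))
    + 2 * avg (fun y => (lam y == lam x)%:R * 1) <= _).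
  rewrite -avgZl -avgD; apply: ler_avg => y.
  have := nu0 y; case: (_ == _); case: (_ \in _) => /=; lra.
rewrite [leRHS]addrC lerD//; first exact: le_trans (ler_norm _) (nu_err _).
rewrite ler_pM2l// avg_fibre_indicator sumr_const ler_pdivrMr//.
by move: xS; rewrite inE.
Qed.

(** The deviation is the correlation of [nu - 1] with the fibre's indicator, divided by the measure
    of the fibre, which exceeds [tau]. *)
Lemma fibre_avg_near1 x : x \notin small_fibres ->
  `|fibre_avg lam nu x - 1| <= err / tau.
Proof.
rewrite inE -ltNge => big.
have n0 : 0 < #|fibre lam x|%:R :> R by rewrite ltr0n card_fibre_gt0.
have -> : fibre_avg lam nu x - 1
  = avg (fun y => (lam y == lam x)%:R * (nu y - 1))
    * (#|T|%:R / #|fibre lam x|%:R).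
  rewrite avg_fibre_indicator big_split /= sumrN sumr_const /fibre_avg.
  by field; rewrite !gt_eqF.
have r0 : 0 <= #|T|%:R / #|fibre lam x|%:R :> R by rewrite divr_ge0 ?ler0n.
rewrite normrM (ger0_norm r0); apply: ler_pM => //.
by rewrite ler_pdivrMr// ler_pdivlMl// ltW.
Qed.

End Exceptional.

(** Refining can only enlarge the exceptional set, so the weighted energy is not automatically
    monotone; the loss has to be bounded by the mass of the new set. *)
Lemma small_fibres_refines (R : realType) (T : finType) (tau : R)
  (P Q : finType) (lam : T -> P) (mu : T -> Q) : refines lam mu ->
  small_fibres tau lam \subset small_fibres tau mu.
Proof.
move=> ref; apply/fintype.subsetP => x; rewrite !inE; apply: le_trans.
rewrite ler_nat subset_leq_card//; apply/fintype.subsetP => y; rewrite !inE.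
by move=> /eqP /ref ->.
Qed.

Section EnergyIncrement.
Variables (R : realType) (T : finType) (nu f : T -> R) (tau : R).
Hypotheses (T0 : (0 < #|T|)%N) (fnu : forall x, 0 <= f x <= nu x).
Hypothesis nu2 : avg nu <= 2.

(** The weight is needed for boundedness: [fibre_avg lam f] is at most 2 only off the exceptional
    set. *)
Definition energy (P : finType) (lam : T -> P) : R :=
  avg (fun x => (1 - (x \in small_fibres tau lam)%:R) * fibre_avg lam f x ^+ 2).

Variables (P Q : finType) (lam : T -> P) (mu : T -> Q).
Hypothesis ref : refines lam mu.
Hypothesis lam2 :
  forall x, x \notin small_fibres tau lam -> fibre_avg lam nu x <= 2.

Let o x : R := (x \in small_fibres tau lam)%:R.
Let o' x : R := (x \in small_fibres tau mu)%:R.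
Let a := fibre_avg lam f.
Let a' := fibre_avg mu f.

Let o01 x : (o x = 0 /\ x \notin small_fibres tau lam) \/ (o x = 1 /\ o' x = 1).
Proof.
rewrite /o /o'; case: (boolP (x \in small_fibres tau lam)) => xS; [right|by left].
by rewrite (fintype.subsetP (small_fibres_refines _ ref)).
Qed.

Let o'01 x : o' x = 0 \/ o' x = 1.
Proof. by rewrite /o'; case: (_ \in _); [right|left]. Qed.

Let a0 x : 0 <= a x.
Proof. by rewrite /a divr_ge0 ?ler0n// sumr_ge0// => y _; case/andP: (fnu y). Qed.

Let a'0 x : 0 <= a' x.
Proof. by rewrite /a' divr_ge0 ?ler0n// sumr_ge0// => y _; case/andP: (fnu y). Qed.

Let a2 x : x \notin small_fibres tau lam -> a x <= 2.
Proof.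
move=> /lam2; apply: le_trans; apply: ler_fibre_avg => y.
by case/andP: (fnu y).
Qed.

Lemma energy_le4 : energy lam <= 4.
Proof.
rewrite -[leRHS](avg_cst 4 T0); apply: ler_avg => x; rewrite -/(o x) -/(a x).
rewrite /o; case: (boolP (x \in _)) => [_|/a2 ax]; first by rewrite subrr mul0r.
rewrite subr0 mul1r; have -> : 4 = 2 ^+ 2 :> R by rewrite -natrX.
by rewrite lerXn2r// nnegrE.
Qed.

(** [G] is nearly constant on the fibres of [mu], so the correlation is carried by [dl], the change
    of the conditional expectation of [f]. This makes [dl] large in L^1, hence in L^2, and
    Pythagoras converts its square norm into energy, up to multiples of [sig] from the change of
    weight. *)
Lemma energy_increment (C eps sig : R) (G : T -> R) :
  1 <= C -> 0 < eps -> sig <= eps / (8 * C) ->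
  sig <= (eps / (4 * C)) ^+ 2 / 24 ->
  avg (fun x => (x \in small_fibres tau mu)%:R * (nu x + 1)) <= sig ->
  (forall x, `|G x| <= C) ->
  (forall x y, mu x = mu y -> `|G x - G y| <= eps / 8) ->
  eps < `|avg (fun x => (1 - (x \in small_fibres tau lam)%:R)
                        * (f x - fibre_avg lam f x) * G x)| ->
  energy lam + (eps / (4 * C)) ^+ 2 / 2 <= energy mu.
Proof.
move=> C1 eps0 sig1 sig2 sig3 GC Gmu; rewrite -/o -/a => corr.
have C0 : 0 < C by lra.
pose Gb := fibre_avg mu G.
have GbG x : `|G x - Gb x| <= eps / 8.
  have /andP[] : G x - eps / 8 <= Gb x <= G x + eps / 8.
    apply: fibre_avg_bounds => y /Gmu; rewrite ler_norml; lra.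
  by rewrite ler_norml; lra.
have GbC x : `|Gb x| <= C.
  rewrite ler_norml; apply: fibre_avg_bounds => y _.
  by rewrite -ler_norml.
have ro x y : mu x = mu y -> o x = o y.
  by move=> /ref /eq_fibre h; rewrite /o !inE h.
have ro' x y : mu x = mu y -> o' x = o' y.
  by move=> /eq_fibre h; rewrite /o' !inE h.
have loo x y : lam x = lam y -> o x = o y.
  by move=> /eq_fibre h; rewrite /o !inE h.
have la x y : lam x = lam y -> a x = a y by apply: fibre_avg_fibre_constant.
have ma x y : mu x = mu y -> a x = a y by move=> /ref /la.
pose dl x := a' x - a x.
(* Off the exceptional set the error is at most [nu + 2], of average at most 4; multiplied by the
   oscillation [eps / 8] this is [eps / 2]. *)
have step1 : `|avg (fun x => (1 - o x) * (f x - a x) * G x)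
    - avg (fun x => (1 - o x) * (f x - a x) * Gb x)| <= eps / 2.
  rewrite -avgB; apply: le_trans (ler_norm_avg _) _.
  apply: le_trans (_ : avg (fun x => (nu x + 2) * (eps / 8)) <= _).
    apply: ler_avg => x; rewrite -mulrBr normrM.
    have /andP[f0 fn] := fnu x; apply: ler_pM => //.
    have [[-> /a2 ax]|[-> _]] := o01 x; last by rewrite subrr mul0r normr0; lra.
    by rewrite subr0 mul1r ler_norml; have := a0 x; lra.
  rewrite avgZr avgD avg_cst//.
  have : (avg nu + 2) * (eps / 8) <= 4 * (eps / 8).
    by rewrite ler_pM2r; have := nu2; lra.
  lra.
have step2 : avg (fun x => (1 - o x) * (f x - a x) * Gb x)
    = avg (fun x => (1 - o x) * dl x * Gb x).
  have e : avg (fun x => (1 - o x) * Gb x * a' x)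
      = avg (fun x => (1 - o x) * Gb x * f x).
    apply: avg_fibre_avg => x y xy.
    by rewrite (ro _ _ xy) /Gb (fibre_avg_fibre_constant G xy).
  transitivity (avg (fun x => (1 - o x) * Gb x * f x)
     - avg (fun x => (1 - o x) * Gb x * a x)).
    by rewrite -avgB; apply: eq_avg => x; ring.
  by rewrite -e -avgB; apply: eq_avg => x; rewrite /dl; ring.
(* The new exceptional set is a union of fibres of [mu], so [a'] and [f] have the same integral over
   it, and [f <= nu] there. *)
have small : avg (fun x => o' x * (a' x + 2)) <= 2 * sig.
  have -> : avg (fun x => o' x * (a' x + 2))
      = avg (fun x => o' x * f x) + 2 * avg o'.
    rewrite -(@avg_fibre_avg R T Q mu f o')// -avgZl -avgD.
    by apply: eq_avg => x; rewrite -/(a' x); ring.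
  have h1 : avg (fun x => o' x * f x) + avg o' <= sig.
    apply: le_trans sig3; rewrite -avgD; apply: ler_avg => x.
    by rewrite -/(o' x); have := fnu x; have [->|->] := o'01 x; lra.
  have : 0 <= avg (fun x => o' x * f x).
    by apply: avg_ge0 => x; have := fnu x; have [->|->] := o'01 x; lra.
  lra.
have diff x : (o' x - o x) * `|dl x| <= o' x * (a' x + 2).
  have := a'0 x; have := a0 x.
  have [[-> /a2 ax]|[-> ->]] := o01 x; last by rewrite subrr mul0r; lra.
  move=> *; have : `|dl x| <= a' x + 2 by rewrite ler_norml /dl; lra.
  by have [->|->] := o'01 x; lra.
(* The old weight gives [eps / (2 * C)]; passing to the new one costs [2 * sig], at most half of
   this. *)
have step3 : eps / (4 * C) <= avg (fun x => (1 - o' x) * `|dl x|).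
  have l1 : eps / 2 < C * avg (fun x => (1 - o x) * `|dl x|).
    apply: lt_le_trans (_ : `|avg (fun x => (1 - o x) * dl x * Gb x)| <= _).
      rewrite -step2; move: step1 corr.
      set u := avg _; set v := avg _ => step1 corr.
      have := ler_distD 0 u v; have := ler_normD (u - v) v.
      by rewrite subrK; lra.
    rewrite -avgZl; apply: le_trans (ler_norm_avg _) _; apply: ler_avg => x.
    have [on oE] : 0 <= 1 - o x /\ `|1 - o x| = 1 - o x.
      by have [[-> _]|[-> _]] := o01 x; rewrite ?subr0 ?subrr ?normr1 ?normr0.
    by rewrite normrM [`|_ * dl x|]normrM oE mulrC; apply: ler_wpM2r; [rewrite mulr_ge0|exact: GbC].
  have l2 : avg (fun x => (1 - o x) * `|dl x|)
      <= avg (fun x => (1 - o' x) * `|dl x|) + 2 * sig.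
    apply: le_trans (lerD (lexx _) small); rewrite -avgD; apply: ler_avg => x.
    by have := diff x; lra.
  have l3 : eps / (2 * C) < avg (fun x => (1 - o x) * `|dl x|).
    by rewrite ltr_pdivrMr ?mulr_gt0//; lra.
  have e1 : eps / (2 * C) = 2 * (eps / (4 * C)) by field; rewrite gt_eqF.
  have e2 : eps / (8 * C) = (eps / (4 * C)) / 2 by field; rewrite gt_eqF.
  by lra.
have step4 : (eps / (4 * C)) ^+ 2 <= avg (fun x => (1 - o' x) * dl x ^+ 2).
  apply: le_trans (_ : avg (fun x => (1 - o' x) * `|dl x|) ^+ 2 <= _).
    have : 0 <= eps / (4 * C) by rewrite divr_ge0//; lra.
    by move=> h; rewrite lerXn2r// nnegrE; apply: le_trans step3.
  have := avg_cauchy_schwarz (fun x => 1 - o' x) (fun x => (1 - o' x) * `|dl x|).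
  have -> : avg (fun x => (1 - o' x) * ((1 - o' x) * `|dl x|))
      = avg (fun x => (1 - o' x) * `|dl x|).
    by apply: eq_avg => x; have [->|->] := o'01 x; ring.
  have -> : avg (fun x => ((1 - o' x) * `|dl x|) ^+ 2)
      = avg (fun x => (1 - o' x) * dl x ^+ 2).
    apply: eq_avg => x; rewrite exprMn real_normK ?num_real//.
    by have [->|->] := o'01 x; ring.
  move=> /le_trans; apply; rewrite ler_piMl//.
    by apply: avg_ge0 => x; rewrite mulr_ge0 ?sqr_ge0//; have [->|->] := o'01 x; lra.
  rewrite -[leRHS](avg_cst 1 T0); apply: ler_avg => x.
  by have [->|->] := o'01 x; rewrite expr2; lra.
(* Orthogonality is exact for the old weight, since [(1 - o) * a] is constant on the fibres of both
   partitions. For the new weight it only holds up to [4 * sig]. *)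
have cross0 : avg (fun x => (1 - o x) * a x * dl x) = 0.
  have e1 : avg (fun x => (1 - o x) * a x * a' x)
      = avg (fun x => (1 - o x) * a x * f x).
    by apply: avg_fibre_avg => x y xy; rewrite (ro _ _ xy) (ma _ _ xy).
  have e2 : avg (fun x => (1 - o x) * a x * a x)
      = avg (fun x => (1 - o x) * a x * f x).
    by apply: avg_fibre_avg => x y xy; rewrite (loo _ _ xy) (la _ _ xy).
  rewrite -[RHS](subrr (avg (fun x => (1 - o x) * a x * f x))) -{1}e1 -e2 -avgB.
  by apply: eq_avg => x; rewrite /dl; ring.
have cross : - (4 * sig) <= avg (fun x => (1 - o' x) * a x * dl x).
  have -> : avg (fun x => (1 - o' x) * a x * dl x)
      = - avg (fun x => (o' x - o x) * a x * dl x).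
    rewrite -[LHS]subr0 -cross0 -avgB -avgN; apply: eq_avg => x; ring.
  rewrite lerN2; apply: le_trans (ler_norm _) _.
  apply: le_trans (ler_norm_avg _) _.
  have -> : 4 * sig = 2 * (2 * sig) by ring.
  apply: le_trans (ler_wpM2l _ small) => //; rewrite -avgZl.
  apply: ler_avg => x; rewrite normrM [`|_ * a x|]normrM (ger0_norm (a0 x)).
  apply: le_trans (ler_wpM2l _ (diff x)) => //.
  have [[-> /a2 ax]|[-> ->]] := o01 x; last by rewrite subrr normr0 !mul0r mulr0.
  rewrite subr0 ger0_norm; last by have [->|->] := o'01 x.
  have -> : 2 * (o' x * `|dl x|) = o' x * 2 * `|dl x| by ring.
  apply: ler_wpM2r => //; exact: ler_wpM2l.
have main : avg (fun x => (1 - o' x) * a' x ^+ 2)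
    = avg (fun x => (1 - o' x) * a x ^+ 2)
      + 2 * avg (fun x => (1 - o' x) * a x * dl x)
      + avg (fun x => (1 - o' x) * dl x ^+ 2).
  by rewrite -avgZl -!avgD; apply: eq_avg => x; rewrite /dl; ring.
have loss : avg (fun x => (1 - o x) * a x ^+ 2) - 4 * sig
    <= avg (fun x => (1 - o' x) * a x ^+ 2).
  rewrite lerBlDr; apply: le_trans (_ :
    avg (fun x => (1 - o' x) * a x ^+ 2) + 2 * avg (fun x => o' x * (a' x + 2)) <= _).
    rewrite -avgZl -avgD; apply: ler_avg => x; have := a'0 x; have := a0 x.
    have [[-> /a2 ax]|[-> ->]] := o01 x; last by lra.
    have [->|->] := o'01 x; rewrite ?subr0 ?subrr !mul1r ?mul0r; first by lra.
    move=> ax0 ax'0; have : a x ^+ 2 <= 2 ^+ 2 by rewrite lerXn2r// nnegrE.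
    by rewrite -natrX; lra.
  by rewrite lerD2l; lra.
(* The total loss is [12 * sig]: 4 from the points that became exceptional and twice 4 from the
   cross term. This is half of the gross gain, hence the 24 in the bound on [sig]. *)
rewrite /energy -/o -/o' -/a -/a'; lra.
Qed.

End EnergyIncrement.

Theorem koopman_von_neumann (R : realType) (C eps del : R) :
  1 <= C -> 0 < eps -> eps <= 1 -> 0 < del ->
  exists (M : nat) (del' : R), 0 < del' /\
  forall (T : finType) (nu f : T -> R) (D : (T -> R) -> Prop),
  (0 < #|T|)%N -> (forall x, 0 <= f x <= nu x) -> avg nu <= 2 ->
  D (fun=> 1) -> (forall G, D G -> forall x, `|G x| <= C) ->
  (forall G : 'I_M -> T -> R, (forall k, D (G k)) ->
    `|avg (fun x => (nu x - 1) * \prod_k G k x)| <= del') ->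
  exists (P : finType) (lam : T -> P) (Om : {set T}),
  [/\ forall x y, lam x = lam y -> (x \in Om) = (y \in Om),
      avg (fun x => (x \in Om)%:R * nu x) <= del,
      forall x, x \notin Om -> `|fibre_avg lam nu x - 1| <= del
    & forall G, D G -> `|avg (fun x => (1 - (x \in Om)%:R)
                           * (f x - fibre_avg lam f x) * G x)| <= eps].
Proof.
move=> C1 eps0 eps1 del0.
have C0 : 0 < C by lra.
(* Thresholds at spacing [s] leave an oscillation of [2 * s], and the increment needs [eps / 8]. *)
pose s := eps / 16.
have s0 : 0 < s by rewrite divr_gt0.
have sC : s <= C by rewrite /s; lra.
pose r := (Num.truncn (2 * C / s)).+1.
have q0 : 0 <= 2 * C / s by rewrite divr_ge0 ?ltW//; lra.
have [r1 r2] : r%:R * s <= 2 * C + s /\ 2 * C < r%:R * s.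
  have /andP[] := truncn_itv q0; rewrite ler_pdivlMr// ltr_pdivrMr// => h1 h2.
  by split=> //; rewrite /r -natr1 mulrDl mul1r lerD2r.
pose gain := (eps / (4 * C)) ^+ 2 / 2.
have gain0 : 0 < gain by rewrite divr_gt0// exprn_gt0// divr_gt0// mulr_gt0.
pose K := (Num.truncn (4 / gain)).+1.
have Kgain : 4 < K%:R * gain.
  by rewrite -ltr_pdivrMr// truncnS_gt.
pose J := (r * K)%N.
pose sig := Num.min (Num.min del 1) (Num.min (eps / (8 * C)) (gain / 12)).
have C8 : 0 < eps / (8 * C) by rewrite divr_gt0// mulr_gt0.
have sig0 : 0 < sig by rewrite !lt_min del0 ltr01 C8; lra.
have [sdel s1 s8 sgain] : [/\ sig <= del, sig <= 1, sig <= eps / (8 * C)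
    & sig <= gain / 12] by split; rewrite /sig !ge_min lexx ?orbT.
(* [N] bounds the number of labels at every stage. Then [tau] makes the exceptional mass at most
   [N * (4 * tau) = sig], and [err] makes [err / tau = sig]. *)
pose N : R := (2 ^ J)%:R.
have N0 : 0 < N by rewrite ltr0n expn_gt0.
pose tau := sig / (4 * N).
have tau0 : 0 < tau by rewrite divr_gt0// mulr_gt0.
pose err := sig * tau.
have err0 : 0 < err by rewrite mulr_gt0.
(* Half of [err] is shared among the at most [J] thresholds as L^1 error; the other half, divided by
   the coefficient mass [L1 ^+ J], becomes the non-correlation level [del']. *)
pose kap := err / (2 * J.+1%:R).
have kap0 : 0 < kap by rewrite divr_gt0// mulr_gt0// ltr0n.
have [M1 [L1 [L11 thr]]] := structured_threshold C1 s0 kap0.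
have L0 : 0 < L1 ^+ J by rewrite exprn_gt0//; lra.
exists (M1 * J)%N, (err / (2 * L1 ^+ J)); split; first by rewrite divr_gt0// mulr_gt0.
move=> T nu f D T0 fnu nu2 D1 DC corr.
have nu0 x : 0 <= nu x by have /andP[] := fnu x; exact: le_trans.
pose w x := nu x + 1.
have w0 x : 0 <= w x by rewrite addr_ge0.
have w3 : avg w <= 3 by rewrite avgD avg_cst//; lra.
(* [k] counts the dual functions adjoined so far; each of them costs [r] thresholds. *)
pose st k (P : finType) (lam : T -> P) := #|P| = (2 ^ (r * k))%N /\
  structured D w (M1 * (r * k)) (L1 ^+ (r * k)) ((r * k)%:R * kap) lam.
pose Om (P : finType) (lam : T -> P) := small_fibres tau lam.
have st_nu k P lam : (k <= K)%N -> @st k P lam ->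
    [/\ avg (fun x => (x \in Om P lam)%:R * (nu x + 1)) <= sig,
        forall x, x \notin Om P lam -> `|fibre_avg lam nu x - 1| <= sig
      & forall x, x \notin Om P lam -> fibre_avg lam nu x <= 2].
  move=> kK [cP slam].
  have rkJ : (r * k <= J)%N by rewrite leq_mul2l kK orbT.
  have {}slam : structured D w (M1 * J) (L1 ^+ J) (err / 2) lam.
    apply: structured_le slam => //; first by rewrite leq_mul2l rkJ orbT.
      by rewrite ler_weXn2l.
    apply: le_trans (_ : J.+1%:R * kap <= _).
      by rewrite ler_pM2r// ler_nat ltnW// ltnS.
    have J0 : J.+1%:R != 0 :> R by rewrite pnatr_eq0.
    rewrite /kap; move: (J.+1%:R) J0 => n n0.
    by have -> : n * (err / (2 * n)) = err / 2 by field.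
  have nu_err p : `|avg (fun x => (lam x == p)%:R * (nu x - 1))| <= err.
    have [g [tg g01 gw]] := slam p.
    have -> : avg (fun x => (lam x == p)%:R * (nu x - 1))
      = avg (fun x => (nu x - 1) * g x)
        + avg (fun x => (nu x - 1) * ((lam x == p)%:R - g x)).
      by rewrite -avgD; apply: eq_avg => x; ring.
    have h1 : `|avg (fun x => (nu x - 1) * g x)| <= err / 2.
      apply: le_trans (tg _ _ corr) _.
      move: (L1 ^+ J) L0 => n n0.
      by have -> : n * (err / (2 * n)) = err / 2 by field; rewrite gt_eqF.
    have h2 : `|avg (fun x => (nu x - 1) * ((lam x == p)%:R - g x))| <= err / 2.
      apply: le_trans gw; apply: le_trans (ler_norm_avg _) _.
      apply: ler_avg => x; rewrite normrM ler_wpM2r// ler_norml /w.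
      by have := nu0 x; lra.
    apply: le_trans (ler_normD _ _) _; lra.
  have far x : x \notin Om P lam -> `|fibre_avg lam nu x - 1| <= sig.
    by move=> /(fibre_avg_near1 T0 tau0 nu_err); rewrite /err mulfK ?gt_eqF.
  split=> //; last by move=> x /far; rewrite ler_norml; lra.
  apply: le_trans (small_fibres_mass T0 tau0 nu_err nu0) _.
  have PN : #|P|%:R <= N by rewrite cP /N ler_nat leq_exp2l.
  have errtau : err <= tau by rewrite /err ler_piMl// ltW.
  apply: le_trans (_ : N * (4 * tau) <= _).
    by apply: ler_pM => //; lra.
  by rewrite /tau mulrCA mulrA mulrC divfK// gt_eqF// mulr_gt0.
have good k P lam : (k <= K)%N -> @st k P lam ->
    (exists G, D G /\ eps < `|avg (fun x => (1 - (x \in Om P lam)%:R)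
                               * (f x - fibre_avg lam f x) * G x)|)
    \/ exists (P : finType) (lam : T -> P) (Om : {set T}),
  [/\ forall x y, lam x = lam y -> (x \in Om) = (y \in Om),
      avg (fun x => (x \in Om)%:R * nu x) <= del,
      forall x, x \notin Om -> `|fibre_avg lam nu x - 1| <= del
    & forall G, D G -> `|avg (fun x => (1 - (x \in Om)%:R)
                           * (f x - fibre_avg lam f x) * G x)| <= eps].
  move=> kK slam; have [m1 m2 m3] := st_nu k P lam kK slam.
  have [|none] := pselect (exists G, D G /\ eps < `|avg (fun x =>
    (1 - (x \in Om P lam)%:R) * (f x - fibre_avg lam f x) * G x)|); first by left.
  right; exists P, lam, (Om P lam); split.
  - by move=> x y /eq_fibre xy; rewrite !inE xy.
  - apply: le_trans sdel; apply: le_trans m1; apply: ler_avg => x.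
    by rewrite ler_wpM2l ?ler0n// lerDl.
  - by move=> x /m2 h; exact: le_trans sdel.
  - by move=> G DG; rewrite leNgt; apply/negP => h; apply: none; exists G.
(* Otherwise each stage supplies a correlating dual function, and after [K] stages the energy is at
   least [K%:R * gain > 4]. *)
apply: contrapT => ngoal.
have iter k : (k <= K)%N -> exists (P : finType) (lam : T -> P),
    st k P lam /\ k%:R * gain <= energy f tau lam.
  elim: k => [_|k IHk kK].
    exists unit, (fun=> tt); split; first split.
    - by rewrite card_unit muln0.
    - by rewrite !muln0 expr0 mul0r; exact: structured_trivial.
    rewrite mul0r; apply: avg_ge0 => x; rewrite mulr_ge0 ?sqr_ge0//.
    by case: (_ \in _) => /=; lra.
  have [P [lam [slam elam]]] := IHk (ltnW kK).
  have [[G [DG corrG]]|//] := good k P lam (ltnW kK) slam.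
  have [cP stl] := slam.
  have L10 : 0 <= L1 by lra.
  have [Q [mu [cQ smu ref muG]]] := refine_by_thresholds w0 L10 s0 r1 sC r2
    (DC _ DG) (thr T D w D1 w0 w3 G DG (DC _ DG)) stl.
  have smu' : st k.+1 Q mu.
    split; first by rewrite cQ cP -expnD mulnS addnC.
    move: smu; rewrite -mulnDr -exprD -mulrDl -natrD.
    by rewrite mulnS addnC.
  exists Q, mu; split=> //.
  have [_ _ lam2] := st_nu _ _ _ (ltnW kK) slam.
  have [mass _ _] := st_nu _ _ _ kK smu'.
  rewrite -natr1 mulrDl mul1r; apply: le_trans (_ : energy f tau lam + gain <= _).
    by rewrite lerD2r.
  apply: (energy_increment T0 fnu nu2 ref lam2 C1 eps0 s8 _ mass (DC _ DG)) => //.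
    by move: sgain; rewrite /gain; lra.
  by move=> x y /muG; rewrite /s; lra.
have [P [lam [slam elam]]] := iter K (leqnn K).
have [_ _ lam2] := st_nu _ _ _ (leqnn K) slam.
have := energy_le4 T0 fnu lam2; lra.
Qed.

(** * The Gowers-Cauchy-Schwarz inequality for products of dual functions *)

Section Resample.
Variables (R : realType) (X : finType) (rho : X -> X -> X).
Hypothesis rho_avg :
  forall g : X -> R, avg (fun x => avg (fun u => g (rho x u))) = avg g.
Hypothesis rhoK : forall x u v, rho (rho x u) v = rho x v.

Lemma avg_resample_sqr (b : X -> R) :
  avg (fun x => avg (fun u => b x * b (rho x u)))
    = avg (fun x => avg (fun u => b (rho x u)) ^+ 2).
Proof.
rewrite -(rho_avg (fun x => avg (fun u => b x * b (rho x u)))).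
apply: eq_avg => x; rewrite expr2 -avgZr; apply: eq_avg => u.
by rewrite -avgZl; apply: eq_avg => v; rewrite rhoK.
Qed.

(** [rho x u] replaces part of [x] by that of [u]. As [a] ignores this part, [b] can first be
    averaged over it; the square of that average is a pair of copies of [b] sharing the rest of
    [x]. *)
Lemma avg_cs_resample (Y : finType) (a b : Y -> X -> R) :
  (forall y x u, a y (rho x u) = a y x) ->
  avg (fun y => avg (fun x => a y x * b y x)) ^+ 2
    <= avg (fun y => avg (fun x => a y x ^+ 2))
       * avg (fun y => avg (fun x => avg (fun u => b y x * b y (rho x u)))).
Proof.
move=> a_rho; pose bb y x := avg (fun u => b y (rho x u)).
have -> : avg (fun y => avg (fun x => a y x * b y x))
    = avg (fun p : Y * X => a p.1 p.2 * bb p.1 p.2).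
  rewrite (avg_pair (fun y x => a y x * bb y x)); apply: eq_avg => y.
  rewrite -(rho_avg (fun x => a y x * b y x)); apply: eq_avg => x.
  by rewrite -avgZl; apply: eq_avg => u; rewrite a_rho.
apply: le_trans (avg_cauchy_schwarz _ _) _.
rewrite (avg_pair (fun y x => a y x ^+ 2)) (avg_pair (fun y x => bb y x ^+ 2)).
by under [X in _ <= _ * X]eq_avg do rewrite avg_resample_sqr.
Qed.

End Resample.

(** The product is at most the [K]-th power of the largest factor; the 1 covers [K = 0]. Mixed
    products are thereby reduced to moments of single factors. *)
Lemma prod_le1DsumX (R : realDomainType) (K : nat) (a : 'I_K -> R) :
  (forall k, 0 <= a k) -> \prod_k a k <= 1 + \sum_k a k ^+ K.
Proof.
case: K a => [a _|K a a0]; first by rewrite !big_ord0 addr0.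
have [k hk] : exists k, forall l, a l <= a k.
  have [k _ hk] := @arg_maxP _ _ _ ord0 xpredT a isT.
  by exists k => l; exact: hk.
apply: le_trans (_ : a k ^+ K.+1 <= _).
  rewrite -[X in _ ^+ X]card_ord -prodr_const.
  by apply: ler_prod => l _; rewrite a0 hk.
rewrite (bigD1 k)//= addrCA lerDl addr_ge0// sumr_ge0// => l _.
exact: exprn_ge0.
Qed.

Section Mix.
Variables (R : realType) (J : finType) (V : J -> finType) (e : {set J}).
Hypothesis V0 : forall j, (0 < #|V j|)%N.
Local Notation I := (sube e).
Local Notation T := (Ve V e).
Implicit Types (S : {set I}) (x y u : T) (w : {ffun I -> bool}) (i : I).

Lemma card_Ve_gt0 : (0 < #|T|)%N.
Proof.
apply/card_gt0P.
by exists [ffun i : I => enum_val (Ordinal (V0 (val i))) : V (val i)].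
Qed.

Definition mix S x y : T := [ffun i : I => if i \in S then x i else y i].

Lemma mixE S x y i : mix S x y i = if i \in S then x i else y i.
Proof. by rewrite ffunE. Qed.

Lemma cubeE x y w i : cube x y w i = if w i then y i else x i.
Proof. by rewrite ffunE. Qed.

(** Exchanging the coordinates in [S] between two independent uniform points preserves their joint
    law; the averaging identities below come from this kind of symmetry. *)
Lemma mix_swapK S :
  involutive (fun p : T * T => (mix S p.1 p.2, mix S p.2 p.1)).
Proof.
by move=> [x y]; congr pair => /=; apply/ffunP => i; rewrite !mixE;
  case: (i \in S).
Qed.

Lemma avg_mix S (g : T -> R) : avg (fun x => avg (fun y => g (mix S x y))) = avg g.
Proof.
rewrite -(avg_pair (fun x y => g (mix S x y))).
rewrite (avg_bij (fun p : T * T => g p.1) (inv_bij (mix_swapK S))).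
rewrite (avg_pair (fun x _ => g x)); apply: eq_avg => x.
by rewrite avg_cst// card_Ve_gt0.
Qed.

Lemma avg_resample S (g : T -> R) :
  avg (fun x => avg (fun u => g (mix S u x))) = avg g.
Proof. by rewrite avg_exchange avg_mix. Qed.

Lemma avg_resample_family (K : finType) S (g : {ffun K -> T} -> R) :
  avg (fun z : {ffun K -> T} => avg (fun u : {ffun K -> T} =>
    g [ffun k => mix S (u k) (z k)])) = avg g.
Proof.
pose sw (p : {ffun K -> T} * {ffun K -> T}) :=
  ([ffun k => mix S (p.2 k) (p.1 k)], [ffun k => mix S (p.1 k) (p.2 k)]).
have swK : involutive sw.
  by move=> [x y]; congr pair => /=; apply/ffunP => k; rewrite !ffunE;
    apply/ffunP => i; rewrite !mixE; case: (i \in S).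
rewrite -(avg_pair (fun z u : {ffun K -> T} => g [ffun k => mix S (u k) (z k)])).
rewrite (avg_bij (fun p : {ffun K -> T} * {ffun K -> T} => g p.1) (inv_bij swK)).
rewrite (avg_pair (fun x _ : {ffun K -> T} => g x)); apply: eq_avg => x.
by rewrite avg_cst// card_ffun expn_gt0 card_Ve_gt0.
Qed.

End Mix.

Section DualBound.
Variables (R : realType) (J : finType) (V : J -> finType) (e : {set J}).
Hypothesis V0 : forall j, (0 < #|V j|)%N.
Local Notation I := (sube e).
Local Notation T := (Ve V e).
Variables (K : nat) (nu f : T -> R) (F : 'I_K -> T -> R) (Mom : R).
Hypotheses (nu0 : forall x, 0 <= nu x) (Fnu : forall k x, `|F k x| <= nu x + 1).

(** The inner average of condition (iii) for [nu + 1], kept as a function on full points that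
    ignores coordinate [i], to avoid points indexed by a smaller edge. *)
Definition half_moment (i : I) (x0 x1 : T) : R :=
  avg (fun u0 : T => avg (fun u1 : T => \prod_(w : {ffun I -> bool})
    (nu (cube (mix [set i] u0 x0) (mix [set i] u1 x1) w) + 1))).

Hypothesis moment : forall i,
  avg (fun x0 => avg (fun x1 => half_moment i x0 x1 ^+ (2 * K))) <= Mom.

Definition supported (w : {ffun I -> bool}) (S : {set I}) :=
  [forall i, w i ==> (i \in S)].

Lemma supportedU1 (w : {ffun I -> bool}) (S : {set I}) i : ~~ w i ->
  supported w (i |: S) = supported w S.
Proof.
move=> wi; apply: eq_forallb => k; rewrite !inE.
by case: eqVneq => [->|//]; rewrite (negbTE wi).
Qed.

Lemma supported_notin (w : {ffun I -> bool}) (S : {set I}) i :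
  i \notin S -> w i -> ~~ supported w S.
Proof. by move=> iS wi; apply/forallPn; exists i; rewrite wi. Qed.

Definition flip (i : I) (w : {ffun I -> bool}) : {ffun I -> bool} :=
  [ffun k => if k == i then ~~ w k else w k].

Lemma flipK i : involutive (flip i).
Proof.
by move=> w; apply/ffunP => k; rewrite !ffunE; case: eqVneq => // _; rewrite negbK.
Qed.

Lemma supported_flip (w : {ffun I -> bool}) (S : {set I}) i : i \notin S -> ~~ w i ->
  supported (flip i w) (i |: S) = supported w S.
Proof.
move=> iS wi; apply: eq_forallb => k; rewrite !inE ffunE.
by case: eqVneq => [->|//]; rewrite (negbTE wi).
Qed.

Lemma prod_cube_split i (P : pred {ffun I -> bool}) (h : {ffun I -> bool} -> R) :
  \prod_(w | P w) h w = \prod_(w | P w && ~~ w i) h w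
    * \prod_(w | P (flip i w) && ~~ w i) h (flip i w).
Proof.
rewrite (bigID (fun w : {ffun I -> bool} => w i)) /= mulrC; congr (_ * _).
rewrite (reindex_inj (inv_inj (flipK i))) /=; apply: eq_bigl => w.
by rewrite ffunE eqxx.
Qed.

Definition fprod (S : {set I}) x0 x1 : R :=
  \prod_(w | supported w S) f (cube x0 x1 w).

(* Interpolates between <f, prod_k D F_k> at the empty set and the 2^|e|-th power
   of the box norm of f at the full set: the coordinates in [S] have been doubled
   by Cauchy-Schwarz, those outside [S] still carry one copy per factor. *)
Definition interp (S : {set I}) : R :=
  avg (fun p : T * {ffun 'I_K -> T} => avg (fun x0 =>
    fprod S x0 p.1 * \prod_k \prod_(w | ~~ supported w S)
      F k (cube x0 (mix S p.1 (p.2 k)) w))).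

Section OneStep.
Variables (S : {set I}) (i : I).
Hypothesis iS : i \notin S.

Let A k (x0 x : T) : R := \prod_(w : {ffun I -> bool} | w i) F k (cube x0 x w).
Let B (p : T * {ffun 'I_K -> T}) (x0 : T) : R :=
  fprod S x0 p.1 * \prod_k \prod_(w | ~~ supported w S && ~~ w i)
    F k (cube x0 (mix S p.1 (p.2 k)) w).
Let Abar (p : T * {ffun 'I_K -> T}) (x0 : T) : R :=
  \prod_k avg (fun u => A k x0 (mix [set i] u (mix S p.1 (p.2 k)))).

Lemma cube_mix1 (x0 u x : T) (w : {ffun I -> bool}) : ~~ w i ->
  cube x0 (mix [set i] u x) w = cube x0 x w.
Proof.
move=> wi; apply/ffunP => k; rewrite !cubeE mixE inE.
by case: eqVneq => [->|//]; rewrite (negbTE wi).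
Qed.

Lemma cube_mix0 (x0 u x : T) (w : {ffun I -> bool}) : w i ->
  cube (mix [set i] u x0) x w = cube x0 x w.
Proof.
move=> wi; apply/ffunP => k; rewrite !cubeE mixE inE.
by case: eqVneq => [->|//]; rewrite wi.
Qed.

Lemma cube_flip (x0 x1 : T) (w : {ffun I -> bool}) : ~~ w i ->
  cube x0 x1 (flip i w) = cube (mix [set i] x1 x0) x1 w.
Proof.
move=> wi; apply/ffunP => k; rewrite !cubeE mixE !inE ffunE.
by case: eqVneq => [->|//]; rewrite (negbTE wi).
Qed.

Lemma mix_mix1 (u x y : T) : mix S x (mix [set i] u y) = mix [set i] u (mix S x y).
Proof.
apply/ffunP => k; rewrite !mixE !inE.
by case: eqVneq => [->|//]; rewrite (negbTE iS).
Qed.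

Lemma mix_mix1l (u x y : T) :
  mix S (mix [set i] u x) y = mix S x y.
Proof.
apply/ffunP => k; rewrite !mixE !inE.
by case: eqVneq => [->|//]; rewrite (negbTE iS).
Qed.

Lemma mixU1 (x y : T) : mix (i |: S) x y = mix [set i] x (mix S x y).
Proof. by apply/ffunP => k; rewrite !mixE !inE; case: eqVneq. Qed.

Let supp_wi (w : {ffun I -> bool}) : supported w S -> ~~ w i.
Proof. by move=> ws; apply/negP => /(supported_notin iS); rewrite ws. Qed.

(** A factor with [w i] reads coordinate [i] from its private copy [p.2 k] and never from [x0]; the
    other factors do the opposite. Averaging that coordinate of the copies affects only [A] and
    leaves [Abar] independent of coordinate [i] of [x0]. *)
Lemma interp_split : interp S = avg (fun p => avg (fun x0 => Abar p x0 * B p x0)).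
Proof.
transitivity (avg (fun p : T * {ffun 'I_K -> T} => avg (fun x0 =>
    (\prod_k A k x0 (mix S p.1 (p.2 k))) * B p x0))).
  apply: eq_avg => p; apply: eq_avg => x0; rewrite /B mulrCA; congr (_ * _).
  rewrite -big_split /=; apply: eq_bigr => k _.
  rewrite (bigID (fun w : {ffun I -> bool} => w i)) /=; congr (_ * _).
  by apply: eq_bigl => w; case: (boolP (w i)) => [/(supported_notin iS)->|];
    rewrite ?andbF.
rewrite (avg_pair (fun (x1 : T) (z : {ffun 'I_K -> T}) => avg (fun x0 =>
    (\prod_k A k x0 (mix S x1 (z k))) * B (x1, z) x0))).
rewrite (avg_pair (fun (x1 : T) (z : {ffun 'I_K -> T}) => avg (fun x0 => Abar (x1, z) x0 * B (x1, z) x0))).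
apply: eq_avg => x1; rewrite avg_exchange [RHS]avg_exchange.
apply: eq_avg => x0.
rewrite -(avg_resample_family V0 [set i]); apply: eq_avg => z.
rewrite /Abar -(avg_ffun_prod (fun k u => A k x0 (mix [set i] u (mix S x1 (z k))))).
rewrite -avgZr; apply: eq_avg => u; congr (_ * _).
  by apply: eq_bigr => k _; rewrite ffunE mix_mix1.
rewrite /B; congr (_ * _); apply: eq_bigr => k _; apply: eq_bigr => w /andP[_ wi].
by rewrite ffunE mix_mix1 cube_mix1.
Qed.

(** [B] does not read coordinate [i] of [p.1], so that free coordinate can serve as the second copy
    produced by Cauchy-Schwarz: vertices with [w i] false give the first [B], the flipped ones the
    second. *)
Lemma interp_doubled : interp (i |: S)
  = avg (fun p => avg (fun x0 => avg (fun u => B p x0 * B p (mix [set i] u x0)))).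
Proof.
transitivity (avg (fun p : T * {ffun 'I_K -> T} => avg (fun x0 =>
    B p x0 * B p (mix [set i] p.1 x0)))).
  apply: eq_avg => -[x1 z] /=; apply: eq_avg => x0.
  rewrite /B mulrACA; congr (_ * _).
    rewrite /fprod (prod_cube_split i); congr (_ * _).
      apply: eq_big => [w|//]; case: (boolP (w i)) => wi.
        by rewrite andbF; apply/esym/negbTE; exact: supported_notin wi.
      by rewrite andbT supportedU1.
    apply: eq_big => [w|w /andP[_ wi]]; last by rewrite cube_flip.
    case: (boolP (w i)) => wi.
      by rewrite andbF; apply/esym/negbTE; exact: supported_notin wi.
    by rewrite andbT supported_flip.
  rewrite -big_split /=; apply: eq_bigr => k _.
  rewrite (prod_cube_split i); congr (_ * _).
    apply: eq_big => [w|w /andP[_ wi]]; last by rewrite mixU1 cube_mix1.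
    by case: (boolP (w i)) => wi; rewrite ?andbF// supportedU1.
  apply: eq_big => [w|w /andP[_ wi]].
    by case: (boolP (w i)) => wi; rewrite ?andbF// supported_flip.
  rewrite cube_flip// mixU1 cube_mix1//; congr (F k (cube _ _ w)).
  by apply/ffunP => l; rewrite !mixE !inE; case: eqVneq.
rewrite (avg_pair (fun (x1 : T) (z : {ffun 'I_K -> T}) => avg (fun x0 =>
    B (x1, z) x0 * B (x1, z) (mix [set i] x1 x0)))).
rewrite (avg_pair (fun (x1 : T) (z : {ffun 'I_K -> T}) => avg (fun x0 => avg (fun u =>
    B (x1, z) x0 * B (x1, z) (mix [set i] u x0))))).
rewrite -(avg_resample V0 [set i]); apply: eq_avg => x1.
rewrite avg_exchange; apply: eq_avg => z; rewrite avg_exchange.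
apply: eq_avg => x0; apply: eq_avg => u.
have BE x : B (mix [set i] u x1, z) x = B (x1, z) x.
  rewrite /B /fprod; congr (_ * _).
    by apply: eq_bigr => w /supp_wi wi; rewrite cube_mix1.
  by apply: eq_bigr => k _; apply: eq_bigr => w _; rewrite mix_mix1l.
rewrite !BE; congr (_ * B _ _).
by apply/ffunP => l; rewrite !mixE !inE; case: eqVneq.
Qed.

Lemma half_moment_ge0 x0 x1 : 0 <= half_moment i x0 x1.
Proof.
apply: avg_ge0 => u; apply: avg_ge0 => v; apply: prodr_ge0 => w _.
by rewrite addr_ge0.
Qed.

(** The factors with [w i] are bounded by [nu + 1]; the remaining factors of the cube can be added
    because each is at least 1. *)
Lemma norm_avg_A_le k x0 x :
  `|avg (fun u => A k x0 (mix [set i] u x))| <= half_moment i x0 x.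
Proof.
rewrite -[leLHS](avg_cst _ (card_Ve_gt0 e V0)); apply: ler_avg => u0.
apply: le_trans (ler_norm_avg _) _; apply: ler_avg => u.
rewrite [leRHS](bigID (fun w : {ffun I -> bool} => w i)) /= -[leLHS]mulr1.
apply: ler_pM => //.
  rewrite normr_prod; apply: ler_prod => w wi; rewrite normr_ge0 /=.
  by rewrite cube_mix0.
apply: le_trans (_ : \prod_(w : {ffun I -> bool} | ~~ w i) 1 <= _).
  by rewrite big1.
by apply: ler_prod => w _; rewrite ler01 lerDr /= nu0.
Qed.

(** Squaring and then [prod_le1DsumX] produce the exponent [2 * K]. Each [mix S p.1 (p.2 k)] is
    uniformly distributed, so [moment] applies to every summand. *)
Lemma avg_Abar_sqr :
  avg (fun p => avg (fun x0 => Abar p x0 ^+ 2)) <= 1 + K%:R * Mom.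
Proof.
pose q k (p : T * {ffun 'I_K -> T}) x0 := half_moment i x0 (mix S p.1 (p.2 k)).
apply: le_trans (_ : avg (fun p => avg (fun x0 =>
    1 + \sum_k q k p x0 ^+ (2 * K))) <= _).
  apply: ler_avg => p; apply: ler_avg => x0.
  rewrite -prodrXl; apply: le_trans (prod_le1DsumX _) _.
    by move=> k; exact: sqr_ge0.
  rewrite lerD2l; apply: ler_sum => k _; rewrite -exprM.
  rewrite -[leLHS]ger0_norm; last by rewrite exprM exprn_ge0 ?sqr_ge0.
  by rewrite normrX lerXn2r ?nnegrE ?half_moment_ge0// norm_avg_A_le.
have T0 : (0 < #|T|)%N := card_Ve_gt0 e V0.
have Z0 : (0 < #|{ffun 'I_K -> T}|)%N by rewrite card_ffun expn_gt0 T0.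
have -> : avg (fun p => avg (fun x0 => 1 + \sum_k q k p x0 ^+ (2 * K)))
  = 1 + \sum_k avg (fun p => avg (fun x0 => q k p x0 ^+ (2 * K))).
  rewrite -avg_sum -[X in _ = X + _](@avg_cst _ (T * {ffun 'I_K -> T})%type 1).
    rewrite -avgD; apply: eq_avg => p; rewrite avgD avg_cst//; congr (_ + _).
    by rewrite avg_sum.
  by rewrite card_prod muln_gt0 T0.
rewrite lerD2l mulr_natl -[K in leRHS]card_ord -sumr_const.
apply: ler_sum => k _; apply: le_trans (moment i).
rewrite /q (avg_pair (fun x1 (z : {ffun 'I_K -> T}) => avg (fun x0 =>
  half_moment i x0 (mix S x1 (z k)) ^+ (2 * K)))).
pose h x1 := avg (fun x0 => half_moment i x0 x1 ^+ (2 * K)).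
rewrite [leRHS]avg_exchange -/h -(avg_mix V0 S h); apply: ler_avg => x1.
have := @avg_ffun_prod R 'I_K T (fun l (z : T) => if l == k then h (mix S x1 z) else 1).
rewrite (bigD1 k)//= eqxx big1 ?mulr1; last first.
  by move=> l /negbTE ->; rewrite avg_cst.
move=> <-; apply: ler_avg => z; rewrite (bigD1 k)//= eqxx big1 ?mulr1//.
by move=> l /negbTE ->.
Qed.

Lemma interp_step : interp S ^+ 2 <= (1 + K%:R * Mom) * interp (i |: S).
Proof.
rewrite interp_split interp_doubled.
pose rho (x u : T) := mix [set i] u x.
have rho_avg (g : T -> R) : avg (fun x => avg (fun u => g (rho x u))) = avg g.
  exact: avg_resample.
have rhoK x u v : rho (rho x u) v = rho x v.
  by apply/ffunP => k; rewrite !mixE !inE; case: eqVneq.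
apply: le_trans (avg_cs_resample rho_avg rhoK B _) _.
  move=> p x0 u; apply: eq_bigr => k _; apply: eq_avg => v.
  by apply: eq_bigr => w wi; rewrite cube_mix0.
apply: ler_wpM2r avg_Abar_sqr; apply: avg_ge0 => p.
rewrite (avg_resample_sqr rho_avg rhoK); apply: avg_ge0 => x.
exact: sqr_ge0.
Qed.

End OneStep.

Hypothesis Mom0 : 0 <= Mom.

Let Cst := 1 + K%:R * Mom.

Let Cst_gt0 : 0 < Cst.
Proof. by rewrite /Cst ltr_pwDl// mulr_ge0. Qed.

(** Each coordinate squares the inequality obtained so far and adds one factor [Cst] from
    [interp_step]. *)
Definition dual_const (n : nat) : R := iter n (fun c => c ^+ 2 * Cst) 1.

Lemma interp_iter (S : {set I}) :
  `|interp finset.set0| ^+ (2 ^ #|S|) <= dual_const #|S| * `|interp S|.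
Proof.
move: {2}#|S| (erefl #|S|) => n; elim: n S => [|n IHn] S cS.
  by move/cards0_eq: cS => ->; rewrite cards0 expr1 mul1r.
have [i iS] : exists i, i \in S by apply/card_gt0P; rewrite cS.
have cS' : #|S :\ i| = n by move: cS; rewrite (cardsD1 i) iS add1n => -[].
have := IHn _ cS'; rewrite cS' cS /= => IH.
have iS' : i \notin S :\ i by rewrite !inE eqxx.
have := interp_step iS'; rewrite finset.setD1K// => step.
rewrite expnSr exprM.
apply: le_trans (_ : (dual_const n * `|interp (S :\ i)|) ^+ 2 <= _).
  have h : 0 <= `|interp finset.set0| ^+ (2 ^ n) by rewrite exprn_ge0.
  by rewrite lerXn2r// nnegrE//; exact: le_trans IH.
rewrite exprMn real_normK ?num_real// -mulrA ler_wpM2l ?sqr_ge0//.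
apply: le_trans step _; rewrite ler_wpM2l ?ler_norm//; exact: ltW.
Qed.

Lemma interp_ge0 (S : {set I}) i : i \in S -> 0 <= interp S.
Proof.
move=> iS; have iS' : i \notin S :\ i by rewrite !inE eqxx.
have := le_trans (sqr_ge0 _) (interp_step iS').
by rewrite finset.setD1K// pmulr_rge0.
Qed.

Lemma supported0 (w : {ffun I -> bool}) :
  supported w finset.set0 = (w == [ffun => false]).
Proof.
apply/forallP/eqP => [h|-> i]; last by rewrite ffunE.
by apply/ffunP => i; rewrite ffunE; have := h i; rewrite inE implybF => /negbTE.
Qed.

Lemma cube_0 (x0 x1 : T) : cube x0 x1 [ffun => false] = x0.
Proof. by apply/ffunP => i; rewrite cubeE ffunE. Qed.

Lemma interp_set0 : interp finset.set0 = avg (fun x => f x * \prod_k De (F k) x).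
Proof.
rewrite /interp (avg_pair (fun (x1 : T) (z : {ffun 'I_K -> T}) =>
  avg (fun x0 => fprod finset.set0 x0 x1 * \prod_k \prod_(w | ~~ supported w finset.set0)
      F k (cube x0 (mix finset.set0 x1 (z k)) w)))).
rewrite -[RHS](avg_cst _ (card_Ve_gt0 e V0)); apply: eq_avg => x1.
rewrite avg_exchange; apply: eq_avg => x0.
rewrite -(avg_ffun_prod (fun k x => \prod_(w | w != [ffun => false])
  F k (cube x0 x w))) -avgZl; apply: eq_avg => z; congr (_ * _).
  by rewrite /fprod (eq_bigl _ _ supported0) big_pred1_eq cube_0.
apply: eq_bigr => k _; apply: eq_big => [w|w _]; first by rewrite supported0.
by congr (F k (cube _ _ w)); apply/ffunP => i; rewrite mixE inE.
Qed.

Lemma interp_setT : interp finset.setT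
  = avg2 (fun x0 x1 : T => \prod_(w : {ffun I -> bool}) f (cube x0 x1 w)).
Proof.
have sT (w : {ffun I -> bool}) : supported w finset.setT.
  by apply/forallP => i; rewrite inE implybT.
rewrite /interp (avg_pair (fun (x1 : T) (z : {ffun 'I_K -> T}) =>
  avg (fun x0 => fprod finset.setT x0 x1 * \prod_k \prod_(w | ~~ supported w finset.setT)
      F k (cube x0 (mix finset.setT x1 (z k)) w)))).
rewrite /avg2 (avg_pair (fun x0 x1 : T => \prod_(w : {ffun I -> bool})
  f (cube x0 x1 w))) [RHS]avg_exchange; apply: eq_avg => x1.
rewrite -[RHS](@avg_cst _ {ffun 'I_K -> T}); last first.
  by rewrite card_ffun expn_gt0 card_Ve_gt0.
apply: eq_avg => z; apply: eq_avg => x0.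
rewrite [X in _ * X]big1 ?mulr1; first by rewrite /fprod (eq_bigl _ _ sT).
by move=> k _; rewrite big1// => w; rewrite sT.
Qed.

Lemma dual_bound : `|avg (fun x => f x * \prod_k De (F k) x)| ^+ (2 ^ #|e|)
  <= dual_const #|e|
     * `|avg2 (fun x0 x1 : T => \prod_(w : {ffun I -> bool}) f (cube x0 x1 w))|.
Proof.
by have := interp_iter finset.setT; rewrite interp_set0 interp_setT cardsT card_sig.
Qed.

End DualBound.

(** * The box norm and its dual functions *)

Section BoxInner.
Variables (R : realType) (J : finType) (V : J -> finType) (e : {set J}).
Local Notation T := (Ve V e).
Implicit Types f g : T -> R.

Definition boxpow f : R :=
  avg2 (fun x0 x1 : T => \prod_(w : {ffun sube e -> bool}) f (cube x0 x1 w)).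

(** The case of no dual functions ([K = 0], [nu = 0]): one Cauchy-Schwarz step bounds a square by a
    positive multiple of the box power. It needs a coordinate, hence a nonempty [e]. *)
Lemma boxpow_ge0 f : (forall j, (0 < #|V j|)%N) -> (0 < #|e|)%N -> 0 <= boxpow f.
Proof.
move=> V0 e0; rewrite /boxpow.
pose F (k : 'I_0) (x : T) : R := 0.
have Fn (k : 'I_0) (x : T) : `|F k x| <= 0 + 1 by rewrite normr0 add0r.
have moment (i : sube e) : avg (fun x0 : T => avg (fun x1 : T =>
    half_moment (fun=> 0 : R) i x0 x1 ^+ (2 * 0))) <= 1.
  rewrite muln0 -[leRHS](avg_cst _ (card_Ve_gt0 e V0)); apply: ler_avg => x.
  by rewrite -[leRHS](avg_cst _ (card_Ve_gt0 e V0)); apply: ler_avg.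
have [j je] := card_gt0P e0.
rewrite -(interp_setT V0 f F).
apply: (@interp_ge0 R J V e V0 0 (fun=> 0) f F 1 (fun=> lexx 0) Fn moment ler01
  _ (exist _ j je)).
by rewrite inE.
Qed.

Lemma boxpow_De f : boxpow f = avg (fun x => f x * De f x).
Proof.
rewrite /boxpow /avg2 (avg_pair (fun x0 x1 : T =>
  \prod_(w : {ffun sube e -> bool}) f (cube x0 x1 w))).
apply: eq_avg => x0; rewrite -avgZl; apply: eq_avg => x1.
rewrite (bigD1 [ffun => false])//=; congr (f _ * _).
by apply/ffunP => i; rewrite !ffunE.
Qed.

Lemma ler_norm_De f g x : (forall y, `|f y| <= g y) -> `|De f x| <= De g x.
Proof.
move=> fg; apply: le_trans (ler_norm_avg _) _; apply: ler_avg => x1.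
by rewrite normr_prod; apply: ler_prod => w _; rewrite normr_ge0 fg.
Qed.

Lemma DeZ a f x : De (fun y => a * f y) x = a ^+ (2 ^ #|e|).-1 * De f x.
Proof.
rewrite -avgZl; apply: eq_avg => x1; rewrite big_split /= prodr_const.
congr (_ ^+ _ * _).
have := cardC1 ([ffun => false] : {ffun sube e -> bool}).
by rewrite card_ffun card_bool card_sig => <-.
Qed.

End BoxInner.

(** * Pseudorandom systems of measures *)

Section Glue.
Variables (R : realType) (J : finType) (V : J -> finType) (e : {set J}).
Variable i : sube e.
Local Notation T := (Ve V e).
Local Notation j := (val i).
Local Notation Z := (Ve V (e :\ j)).

Lemma glue_at_self (z : Z) (y : V j) : glue_at z y i = y.
Proof.
rewrite /glue_at; case: eqP => // h.
by rewrite (eq_irrelevance (esym h) erefl).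
Qed.

Lemma glue_at_other (z : Z) (y y' : V j) (k : sube e) :
  k != i -> glue_at z y k = glue_at z y' k.
Proof.
move=> ki; rewrite /glue_at; case: eqP => // h.
by rewrite (val_inj h) eqxx in ki.
Qed.

Lemma sube_setD1W (k : sube (e :\ j)) : val k \in e.
Proof. by have := valP k; rewrite in_setD1 => /andP[]. Qed.

Definition unglue (x : T) : Z * V j :=
  ([ffun k : sube (e :\ j) => x (exist _ (val k) (sube_setD1W k)) : V (val k)], x i).

Lemma glueK : cancel (fun p : Z * V j => Defs.glue p.1 p.2) unglue.
Proof.
move=> [z y]; congr pair => /=; last by rewrite ffunE glue_at_self.
apply/ffunP => -[k hk]; rewrite !ffunE /glue_at /=; case: eqP => [h|h].
  by exfalso; move: hk; rewrite in_setD1 h eqxx.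
by congr (z (exist _ _ _)); exact: bool_irrelevance.
Qed.

Lemma unglueK : cancel unglue (fun p : Z * V j => Defs.glue p.1 p.2).
Proof.
move=> x; apply/ffunP => k; rewrite ffunE /unglue /=.
have [->|ki] := eqVneq k i; first by rewrite glue_at_self.
case: k ki => k hk ki; rewrite /glue_at /=; case: eqP => [h|h].
  by exfalso; move: ki; rewrite -val_eqE /= => /eqP; apply.
by rewrite ffunE /=; congr (x (exist _ _ _)); exact: bool_irrelevance.
Qed.

Lemma avg_glue (Phi : T -> R) :
  avg Phi = avg (fun z : Z => avg (fun y : V j => Phi (Defs.glue z y))).
Proof.
rewrite -(avg_pair (fun (z : Z) (y : V j) => Phi (Defs.glue z y))).
rewrite (@avg_bij _ _ _ (fun p : Z * V j => Defs.glue p.1 p.2))//.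
by exists unglue; [exact: glueK|exact: unglueK].
Qed.

Lemma mix_glue (z z' : Z) (y y' : V j) :
  mix [set i] (Defs.glue z y) (Defs.glue z' y') = Defs.glue z' y.
Proof.
apply/ffunP => k; rewrite mixE !ffunE inE.
by case: eqVneq => [->|ki]; rewrite ?glue_at_self//; exact: glue_at_other.
Qed.

Lemma avg_half_moment (nu : T -> R) (m : nat) : (forall k, (0 < #|V k|)%N) ->
  avg (fun x0 => avg (fun x1 => half_moment nu i x0 x1 ^+ m))
  = avg2 (fun z0 z1 : Z => avg2 (fun y0 y1 : V j =>
      \prod_(w : {ffun sube e -> bool})
        (nu (cube (Defs.glue z0 y0) (Defs.glue z1 y1) w) + 1)) ^+ m).
Proof.
move=> V0; have Z0 : (0 < #|Z|)%N := card_Ve_gt0 _ V0.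
have avgZ (c : R) : avg (fun _ : Z => c) = c by exact: avg_cst.
have avgV (c : R) : avg (fun _ : V j => c) = c by exact: avg_cst.
have hmE z0 z1 y0 y1 : half_moment nu i (Defs.glue z0 y0) (Defs.glue z1 y1)
    = avg2 (fun y0 y1 : V j => \prod_(w : {ffun sube e -> bool})
        (nu (cube (Defs.glue z0 y0) (Defs.glue z1 y1) w) + 1)).
  rewrite /avg2 (avg_pair (fun y0 y1 : V j => \prod_(w : {ffun sube e -> bool})
        (nu (cube (Defs.glue z0 y0) (Defs.glue z1 y1) w) + 1))).
  rewrite /half_moment avg_glue -[RHS]avgZ; apply: eq_avg => z.
  apply: eq_avg => u0; rewrite avg_glue -[RHS]avgZ; apply: eq_avg => z'.
  by apply: eq_avg => u1; rewrite !mix_glue.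
rewrite /avg2 (avg_pair (fun z0 z1 : Z => avg (fun p : V j * V j =>
      \prod_(w : {ffun sube e -> bool})
        (nu (cube (Defs.glue z0 p.1) (Defs.glue z1 p.2) w) + 1)) ^+ m)).
rewrite avg_glue; apply: eq_avg => z0; rewrite -[RHS]avgV; apply: eq_avg => y0.
rewrite avg_glue; apply: eq_avg => z1; rewrite -[RHS]avgV; apply: eq_avg => y1.
by rewrite hmE.
Qed.

End Glue.

Section Restrict.
Variables (R : realType) (J : finType) (V : J -> finType) (e : {set J}).

Definition overwrite (x : VJ V) (z : Ve V e) : VJ V :=
  [ffun j : J => match pselect (j \in e) with
    | left h => z (exist _ j h) | right _ => x j end : V j].

Lemma overwrite_swapK :
  involutive (fun p : VJ V * Ve V e => (overwrite p.1 p.2, restr e p.1)).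
Proof.
move=> [x z]; congr pair => /=; apply/ffunP.
  move=> j; rewrite ffunE; case: (pselect (j \in e)) => h; first by rewrite ffunE.
  by rewrite ffunE; case: (pselect (j \in e)).
move=> [j hj]; rewrite !ffunE /=; case: (pselect (j \in e)) => [h|//].
by congr (z (exist _ _ _)); exact: bool_irrelevance.
Qed.

(** [overwrite_swapK] exchanges the coordinates of [x] in [e] with an independent [z], so the
    restriction of a uniform point is uniform. *)
Lemma avg_restr (g : Ve V e -> R) : (forall j, (0 < #|V j|)%N) ->
  avg (fun x : VJ V => g (restr e x)) = avg g.
Proof.
move=> V0.
have X0 : (0 < #|VJ V|)%N.
  by apply/card_gt0P; exists [ffun j : J => enum_val (Ordinal (V0 j)) : V j].
have Z0 : (0 < #|Ve V e|)%N := card_Ve_gt0 e V0.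
transitivity (avg (fun p : VJ V * Ve V e => g (restr e p.1))).
  rewrite (avg_pair (fun (x : VJ V) (_ : Ve V e) => g (restr e x))).
  by apply: eq_avg => x; rewrite avg_cst.
rewrite (avg_bij (fun p : VJ V * Ve V e => g p.2) (inv_bij overwrite_swapK)).
rewrite (avg_pair (fun (_ : VJ V) (z : Ve V e) => g z)).
by rewrite avg_cst.
Qed.

End Restrict.

Lemma exprn_sum_le (R : realDomainType) (I : finType) (t : I -> R) (m : nat) :
  (0 < #|I|)%N -> (forall k, 0 <= t k) ->
  (\sum_k t k) ^+ m <= \sum_k (#|I|%:R * t k) ^+ m.
Proof.
move=> /card_gt0P[k0 _] t0.
have [k hk] : exists k, forall l, t l <= t k.
  have [k _ hk] := @arg_maxP _ _ _ k0 xpredT t isT.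
  by exists k => l; exact: hk.
apply: le_trans (_ : (#|I|%:R * t k) ^+ m <= _).
  rewrite lerXn2r ?nnegrE ?mulr_ge0 ?sumr_ge0 ?ler0n//.
  by rewrite mulr_natl -sumr_const ler_sum.
rewrite (bigD1 k)//= lerDl sumr_ge0// => l _.
by rewrite exprn_ge0// mulr_ge0 ?ler0n.
Qed.

Lemma cvgn_sum (R : realType) (I : finType) (u : I -> nat -> R) (l : I -> R) :
  (forall i, u i n @[n --> \oo] --> l i) ->
  \sum_i u i n @[n --> \oo] --> \sum_i l i.
Proof.
move=> ul; elim: (index_enum I) => [|i s IHs].
  by rewrite big_nil; under eq_fun do rewrite big_nil; exact: cvg_cst.
by rewrite big_cons; under eq_fun do rewrite big_cons; exact: cvgD.
Qed.

Lemma cvgn_le (R : realType) (u : nat -> R) (l a : R) :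
  u n @[n --> \oo] --> l -> l < a -> exists N, forall n, (N <= n)%N -> u n <= a.
Proof.
move=> /cvgrPdist_le /(_ (a - l)) h la.
have [N _ hN] := h ltac:(by rewrite subr_gt0).
exists N => n /hN /=; rewrite distrC ler_norml => /andP[_]; lra.
Qed.

(** At [n] the accuracy used is the best [k <= n] already valid, that is with [N k <= n]. Each [k]
    eventually qualifies, so the rate tends to 0; from [N 0] on some [k] qualifies. *)
Lemma diagonal_rate (R : realType) (P : R -> nat -> Prop) :
  (forall k : nat, exists N, forall n, (N <= n)%N -> P k.+1%:R^-1 n) ->
  exists c : nat -> R, c n @[n --> \oo] --> (0 : R) /\
    exists N0, forall n, (N0 <= n)%N -> P (c n) n.
Proof.
move=> /choice[N hN].
pose K n := \max_(k < n.+1 | (N k <= n)%N) k.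
exists (fun n => (K n).+1%:R^-1); split.
  have K_ge k n : (k <= n)%N -> (N k <= n)%N -> (k <= K n)%N.
    move=> kn Nkn; rewrite -ltnS in kn.
    exact: (@leq_bigmax_cond _ _ (fun k : 'I_n.+1 => k : nat) (Ordinal kn)).
  apply/cvgrPdist_le => eps eps0.
  pose k := Num.truncn eps^-1.
  have keps : k.+1%:R^-1 <= eps.
    by rewrite -[leRHS]invrK lef_pV2 ?posrE ?invr_gt0 ?ltr0n// ltW// truncnS_gt.
  exists (maxn k (N k)) => // n /=; rewrite geq_max => /andP[kn Nkn].
  rewrite sub0r normrN ger0_norm ?invr_ge0 ?ler0n//; apply: le_trans keps.
  by rewrite lef_pV2 ?posrE ?ltr0n// ler_nat ltnS K_ge.
exists (N 0%N) => n N0n; apply: hN; rewrite /K.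
have [|k Nk ->] := @eq_bigmax_cond _ (fun k : 'I_n.+1 => (N k <= n)%N)
  (fun k => k : nat); last exact: Nk.
by apply/card_gt0P; exists ord0; exact: N0n.
Qed.

Section FibreSigmaAlgebra.
Variables (R : realType) (T P : finType) (lam : T -> P).

Definition fibre_sets : {set {set T}} :=
  [set A : {set T} | [forall x, [forall y,
    (lam x == lam y) ==> ((x \in A) == (y \in A))]]].

Lemma fibre_setsP (A : {set T}) :
  reflect (forall x y, lam x = lam y -> (x \in A) = (y \in A))
          (A \in fibre_sets).
Proof.
rewrite inE; apply: (iffP idP) => [/forallP h x y xy|h].
  by have /forallP/(_ y) := h x; rewrite xy eqxx => /eqP.
apply/forallP => x; apply/forallP => y; apply/implyP => /eqP xy.
by rewrite (h _ _ xy).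
Qed.

Lemma fibre_sets_sigma_alg : is_sigma_alg fibre_sets.
Proof.
split.
- by apply/fibre_setsP => x y _; rewrite !inE.
- by move=> A /fibre_setsP hA; apply/fibre_setsP => x y xy; rewrite !inE (hA _ _ xy).
move=> A C /fibre_setsP hA /fibre_setsP hC; apply/fibre_setsP => x y xy.
by rewrite !inE (hA _ _ xy) (hC _ _ xy).
Qed.

Lemma atom_fibre_sets x : atom fibre_sets x = fibre lam x.
Proof.
apply/setP => y; apply/finset.bigcapP/idP => [h|].
  apply: h; rewrite fibre_refl andbT; apply/fibre_setsP => a b ab.
  by rewrite !inE ab.
by rewrite inE => /eqP yx A /andP[/fibre_setsP hA]; rewrite (hA _ _ yx).
Qed.

Lemma condE_fibre_sets (f : T -> R) : condE fibre_sets f = fibre_avg lam f.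
Proof. by apply/funext => x; rewrite /condE atom_fibre_sets. Qed.

End FibreSigmaAlgebra.

Section Pseudorandom.
Variables (R : realType) (J : finType) (H : {set {set J}}) (V : nat -> J -> finType).
Variables (nu : forall n (e : {set J}), Ve (V n) e -> R) (e : {set J}).
Arguments nu : clear implicits.
Hypotheses (V0 : forall n j, (0 < #|V n j|)%N) (Hnu : pseudorandom H V nu).
Hypothesis eH : e \in H.
Local Notation I := (sube e).

(** Expanding the product of [nu + 1] gives one term per set of vertices, each bounded by condition
    (iii). There are finitely many coordinates and vertex sets, so one [Mom] serves all [i] and
    [n]. *)
Lemma pseudorandom_half_moment (m : nat) : exists2 Mom : R, 0 <= Mom &
  forall n (i : I), avg (fun x0 => avg (fun x1 =>
    half_moment (nu n e) i x0 x1 ^+ m)) <= Mom.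
Proof.
have [[nu0 _] _ _ corr] := Hnu.
have {corr} /choice[C hC] : forall q : I * {set {ffun I -> bool}},
    exists C : R, forall n, `| avg2 (fun z0 z1 : Ve (V n) (e :\ val q.1) =>
      (avg2 (fun y0 y1 : V n (val q.1) => \prod_(w : {ffun I -> bool})
        (if w \in q.2 then nu n e (cube (Defs.glue z0 y0) (Defs.glue z1 y1) w)
         else 1))) ^+ m) | <= C.
  by move=> [i A]; exact: (corr e (val i) eH (valP i) (fun w => w \in A) m).
pose N : R := #|{set {ffun I -> bool}}|%:R.
exists (\sum_q N ^+ m * `|C q|).
  by apply: sumr_ge0 => q _; rewrite mulr_ge0// exprn_ge0// ler0n.
move=> n i; rewrite avg_half_moment//.
apply: le_trans (_ : \sum_A N ^+ m * `|C (i, A)| <= _); last first.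
  have -> : \sum_q N ^+ m * `|C q| = \sum_i \sum_A N ^+ m * `|C (i, A)|.
    by rewrite pair_bigA; apply: eq_bigr => -[].
  rewrite [leRHS](bigD1 i)//=.
  rewrite lerDl; apply: sumr_ge0 => k _; apply: sumr_ge0 => A _.
  by rewrite mulr_ge0// exprn_ge0// ler0n.
pose t z0 z1 A := avg2 (fun y0 y1 : V n (val i) => \prod_(w : {ffun I -> bool})
  (if w \in (A : {set _})
   then nu n e (cube (Defs.glue z0 y0) (Defs.glue z1 y1) w) else 1)).
apply: le_trans (_ : avg2 (fun z0 z1 => \sum_A (N * t z0 z1 A) ^+ m) <= _).
  apply: ler_avg => -[z0 z1] /=.
  have -> : avg2 (fun y0 y1 : V n (val i) => \prod_(w : {ffun I -> bool})
      (nu n e (cube (Defs.glue z0 y0) (Defs.glue z1 y1) w) + 1))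
      = \sum_A t z0 z1 A.
    by rewrite -avg_sum; apply: eq_avg => -[y0 y1] /=; rewrite bigA_distr.
  apply: exprn_sum_le; first by apply/card_gt0P; exists finset.set0.
  move=> A; apply: avg_ge0 => y; apply: prodr_ge0 => w _.
  by case: ifP => // _; exact: nu0.
rewrite /avg2 avg_sum; apply: ler_sum => A _.
have := hC (i, A) n; rewrite /avg2 /= => hA.
under eq_avg do rewrite exprMn.
rewrite avgZl ler_wpM2l ?exprn_ge0 ?ler0n//.
by apply: le_trans (ler_norm _) _; apply: le_trans hA (ler_norm _).
Qed.

Lemma pseudorandom_cube_moment (A : {set {ffun I -> bool}}) :
  avg2 (fun x0 x1 : Ve (V n) e => \prod_(w : {ffun I -> bool})
    (if w \in A then nu n e (cube x0 x1 w) else 1)) @[n --> \oo] --> (1 : R).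
Proof.
have [_ _ lin _] := Hnu.
(* Condition (ii) asks for exponents on every edge: [A], transported along [e = e'], on [e], and
   zero on the others. *)
pose expo (e' : {set J}) : {ffun sube e' -> bool} -> bool :=
  match e =P e' with
  | ReflectT h => eq_rect e (fun e0 => {ffun sube e0 -> bool} -> bool)
                    (fun w => w \in A) e' h
  | ReflectF _ => fun=> false end.
have expoE w : expo e w = (w \in A).
  by rewrite /expo; case: eqP => // h; rewrite (eq_irrelevance h erefl).
have expoN e' w : e' != e -> expo e' w = false.
  by rewrite /expo; case: eqP => // ee' /eqP; case; exact: esym.
rewrite (_ : (fun n => _) = (fun n => avg2 (fun x0 x1 : VJ (V n) =>
    \prod_(e' in H) \prod_(w : {ffun sube e' -> bool})
      (if expo e' w then nu n e' (cube (restr e' x0) (restr e' x1) w) else 1))));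
  first exact: lin.
apply/funext => n; apply: esym.
pose h x0 x1 : R := \prod_(w : {ffun I -> bool})
  (if w \in A then nu n e (cube x0 x1 w) else 1).
transitivity (avg2 (fun x0 x1 : VJ (V n) => h (restr e x0) (restr e x1))).
  apply: eq_avg => -[x0 x1] /=; rewrite (bigD1 e)//= [X in _ * X]big1 ?mulr1.
    by apply: eq_bigr => w _; rewrite expoE.
  by move=> e' /andP[_ e'e]; rewrite big1// => w _; rewrite expoN.
rewrite /avg2 (avg_pair (fun x0 x1 : VJ (V n) => h (restr e x0) (restr e x1))).
rewrite (avg_pair h) -[RHS](avg_restr _ (V0 n)); apply: eq_avg => x0.
by rewrite (avg_restr (h (restr e x0)) (V0 n)).
Qed.

Lemma pseudorandom_boxpow :
  boxpow (fun x => nu n e x - 1) @[n --> \oo] --> (0 : R).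
Proof.
pose s (A : {set {ffun I -> bool}}) : R :=
  \prod_(w : {ffun I -> bool}) (if w \in A then 1 else -1).
(* Every term of the expansion tends to its sign, and the signs add up to a product of factors
   [1 - 1]. *)
have -> : (0 : R) = \sum_A s A * 1.
  under eq_bigr do rewrite mulr1.
  by rewrite -bigA_distr (bigD1 [ffun => false])//= subrr mul0r.
rewrite (_ : (fun n => _) = (fun n => \sum_A s A *
  avg2 (fun x0 x1 : Ve (V n) e => \prod_(w : {ffun I -> bool})
    (if w \in A then nu n e (cube x0 x1 w) else 1)))); last first.
  apply/funext => n; under [RHS]eq_bigr do rewrite -avgZl.
  rewrite -avg_sum; apply: eq_avg => -[x0 x1] /=; rewrite bigA_distr.
  apply: eq_bigr => A _; rewrite -big_split /=; apply: eq_bigr => w _.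
  by case: ifP => _; rewrite ?mul1r ?mulr1.
apply: cvgn_sum => A; apply: cvgM; first exact: cvg_cst.
exact: pseudorandom_cube_moment.
Qed.

(** The bound [nu + 1], rather than [nu], admits the constant 1 and half of the normalised error,
    and it is the one matched by condition (i). *)
Definition dual_functions n (G : Ve (V n) e -> R) : Prop :=
  exists F, (forall x, `|F x| <= nu n e x + 1) /\ G = De F.

Lemma pseudorandom_dual_corr (M : nat) (del : R) : 0 < del ->
  exists N, forall n, (N <= n)%N -> forall G : 'I_M -> Ve (V n) e -> R,
    (forall k, dual_functions (G k)) ->
    `|avg (fun x => (nu n e x - 1) * \prod_k G k x)| <= del.
Proof.
move=> del0; have [[nu0 _] _ _ _] := Hnu.
have [Mom Mom0 moment] := pseudorandom_half_moment (2 * M).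
pose c := dual_const M Mom #|e|.
have c_gt0 : 0 < c.
  rewrite /c; elim: #|e| => //= k IHk.
  by rewrite mulr_gt0 ?exprn_gt0// ltr_pwDl// mulr_ge0 ?ler0n.
have del0' : 0 < del ^+ (2 ^ #|e|) / c by rewrite divr_gt0// exprn_gt0.
have := pseudorandom_boxpow => /cvgrPdist_le /(_ _ del0') [N _ hN].
exists N => n /hN; rewrite /= sub0r normrN => box G /choice[F hF].
have Fnu k x : `|F k x| <= nu n e x + 1 by have [] := hF k.
have -> : avg (fun x => (nu n e x - 1) * \prod_k G k x)
    = avg (fun x => (nu n e x - 1) * \prod_k De (F k) x).
  apply: eq_avg => x; congr (_ * _); apply: eq_bigr => k _.
  by have [_ ->] := hF k.
have n2 : (0 < 2 ^ #|e|)%N by rewrite expn_gt0.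
rewrite -(ler_pXn2r n2) ?nnegrE ?(ltW del0)//.
apply: le_trans (dual_bound (V0 n) (fun x => nu n e x - 1)
  (fun x => nu0 n e x eH) Fnu (moment n) Mom0) _.
by rewrite -/c mulrC -ler_pdivlMr.
Qed.

End Pseudorandom.

Lemma boxnorm_le (R : realType) (J : finType) (V : J -> finType) (e : {set J})
    (g : Ve V e -> R) (eps : R) :
  0 < eps -> eps <= 1 -> 0 <= boxpow g <= eps ->
  boxnorm g <= eps `^ ((2 ^ #|J|)%:R)^-1.
Proof.
move=> eps0 eps1 /andP[g0 geps].
apply: le_trans (_ : eps `^ ((2 ^ #|e|)%:R)^-1 <= _).
  by rewrite ge0_ler_powR// ?invr_ge0 ?ler0n ?nnegrE// ltW.
apply: ger_powR; first by rewrite eps0.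
by rewrite lef_pV2 ?posrE ?ltr0n ?expn_gt0// ler_nat leq_exp2l// max_card.
Qed.

Theorem mainTheorem10 (R : realType) (J : finType) (d : nat)
  (H : {set {set J}}) (V : nat -> J -> finType)
  (nu : forall n (e : {set J}), Ve (V n) e -> R)
  (e : {set J}) (f : forall n, Ve (V n) e -> R) :
  hypergraph_system d H V ->
  pseudorandom H V nu ->
  e \in H ->
  (forall n x, 0 <= f n x <= nu n e x) ->
  exists eps0 : R, 0 < eps0 /\
  forall eps : R, 0 < eps -> eps < 1 -> eps < eps0 ->
  exists c : nat -> R, c n @[n --> \oo] --> (0 : R) /\
  exists N0 : nat, forall n : nat, (N0 <= n)%N ->
  exists (B : {set {set Ve (V n) e}}) (Om : {set Ve (V n) e}),
    [/\ is_sigma_alg B, Om \in B,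
        `| avg (fun x => (x \in Om)%:R * nu n e x) | <= c n,
        (forall x, x \notin Om -> `| condE B (nu n e) x - 1 | <= c n)
      & boxnorm (fun x => (1 - (x \in Om)%:R) * (f n x - condE B (f n) x))
          <= eps `^ ((2 ^ #|J|)%:R)^-1].
Proof.
move=> [d0 Hd V0] Hnu eH fnu.
exists 1; split=> // eps eps0 eps1 _.
apply: (@diagonal_rate R (fun c n =>
  exists (B : {set {set Ve (V n) e}}) (Om : {set Ve (V n) e}),
    [/\ is_sigma_alg B, Om \in B,
        `| avg (fun x => (x \in Om)%:R * nu n e x) | <= c,
        (forall x, x \notin Om -> `| condE B (nu n e) x - 1 | <= c)
      & boxnorm (fun x => (1 - (x \in Om)%:R) * (f n x - condE B (f n) x))
          <= eps `^ ((2 ^ #|J|)%:R)^-1])) => k.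
set del := k.+1%:R^-1.
have del0 : 0 < del by rewrite invr_gt0 ltr0n.
have del1 : del <= 1 by rewrite invf_le1 ?ltr0n// ler1n.
have e0 : (0 < #|e|)%N by rewrite (Hd _ eH).
have [[nu0 nu1] [C0 hC0] _ _] := Hnu.
pose C := 1 + `|C0|.
have C1 : 1 <= C by rewrite lerDl.
(* [De] is homogeneous of degree [2 ^ #|e| - 1], so testing with half of [g] costs this factor; the
   structure theorem is therefore applied at level [eps * r]. *)
pose r := (2^-1 : R) ^+ (2 ^ #|e|).-1.
have r0 : 0 < r by rewrite exprn_gt0// invr_gt0.
have r1 : r <= 1 by rewrite exprn_ile1// ?invr_ge0// invf_le1// ler1n.
have er0 : 0 < eps * r by rewrite mulr_gt0.
have er1 : eps * r <= 1 by rewrite mulr_ile1// ltW.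
have [M [del' [del'0 kvn]]] := koopman_von_neumann C1 er0 er1 del0.
have [N1 hN1] := pseudorandom_dual_corr V0 Hnu eH M del'0.
have [N2 hN2] : exists N, forall n, (N <= n)%N -> avg (nu n e) <= 2.
  by apply: cvgn_le (nu1 e eH) _; rewrite ltr1n.
exists (maxn N1 N2) => n; rewrite geq_max => /andP[/hN1 corr /hN2 avg2nu].
have T0 : (0 < #|Ve (V n) e|)%N := card_Ve_gt0 e (V0 n).
have [|||P [lam [Om [Omlam Omnu Omc OmG]]]] := kvn _ (nu n e) (f n)
  (@dual_functions R J V nu e n) T0 (fnu n) avg2nu.
- exists (fun=> 1); split; first by move=> x; rewrite normr1 lerDr nu0.
  apply/funext => x; rewrite /De -[LHS](avg_cst _ T0); apply: eq_avg => y.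
  by rewrite big1.
- move=> G [F [Fnu ->]] x; apply: le_trans (ler_norm_De x Fnu) _.
  apply: le_trans (ler_norm _) _; apply: le_trans (hC0 n e eH x) _.
  by apply: le_trans (ler_norm _) _; rewrite lerDr.
- exact: corr.
exists (fibre_sets lam), Om; rewrite !condE_fibre_sets.
split=> //; first exact: fibre_sets_sigma_alg.
- exact/fibre_setsP.
- rewrite ger0_norm//; apply: avg_ge0 => x.
  by rewrite mulr_ge0 ?ler0n// nu0.
set g := (fun x => _).
apply: boxnorm_le => //; first exact: ltW.
rewrite boxpow_ge0//= boxpow_De.
(* Off [Om] the average of [f] is at most that of [nu], hence at most 2, so [g] is bounded by
   [nu + 2]. *)
have gnu x : `|2^-1 * g x| <= nu n e x + 1.
  have nux := nu0 n e x eH.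
  rewrite normrM ger0_norm ?invr_ge0// ler_pdivrMl//.
  rewrite /g; case: (boolP (x \in Om)) => xOm.
    by rewrite subrr mul0r normr0; lra.
  have /andP[fx0 fx1] := fnu n x.
  have a0 : 0 <= fibre_avg lam (f n) x.
    rewrite divr_ge0 ?ler0n// sumr_ge0// => y _.
    by have /andP[] := fnu n y.
  have : fibre_avg lam (f n) x <= 2.
    apply: le_trans (_ : fibre_avg lam (nu n e) x <= _).
      by apply: ler_fibre_avg => y; have /andP[] := fnu n y.
    by have := Omc x xOm; rewrite ler_norml; lra.
  by rewrite subr0 mul1r ler_norml; lra.
have := OmG _ (ex_intro _ _ (conj gnu erefl)).
have -> : avg (fun x => (1 - (x \in Om)%:R) * (f n x - fibre_avg lam (f n) x)
    * De (fun y => 2^-1 * g y) x) = r * avg (fun x => g x * De g x).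
  by rewrite -avgZl; apply: eq_avg => x; rewrite DeZ mulrCA.
rewrite normrM gtr0_norm// mulrC ler_pM2r//.
exact: le_trans (ler_norm _).
Qed.
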